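(* Let $q$ be a prime power, let $\phi \neq z$ be a monic irreducible polynomial over $\mathbb{F}_q$ of degree $m_{\phi}$, and let $k \geq 2$ be an integer. For each $n \geq 1$, let $p_n$ be the probability that a uniformly chosen element $\alpha \in GL(n,q)$ has the largest part of the partition $\lambda_{\phi}(\alpha)$ less than $k$ (the empty partition is allowed and has largest part $0$). Then \[ \lim_{n \to \infty} p_n = \prod_{\substack{r \geq 1 \\ r \equiv 0, \pm k \ (\mathrm{mod}\ 2k+1)}} \left(1 - \frac{1}{q^{m_{\phi} r}}\right). \]
   Context: For $\alpha \in GL(n,q)$, the space $\mathbb{F}_q^n$ becomes a finitely generated torsion $\mathbb{F}_q[z]$-module with $z$ acting as $\alpha$; by the structure theory (rational canonical form) it decomposes uniquely as a direct sum of cyclic modules $\mathbb{F}_q[z]/(\phi^{a})$ with $\phi$ monic irreducible and $a \geq 1$. For a monic irreducible $\phi$, $\lambda_{\phi}(\alpha)$ denotes the partition whose parts are the exponents $a$ occurring with the polynomial $\phi$ in this decomposition (the empty partition if $\phi$ does not occur). The conjugacy class of $\alpha$ is determined by the data $\{\lambda_\phi(\alpha)\}_\phi$, which satisfies $\lambda_z(\alpha)=\emptyset$ and $\sum_\phi |\lambda_\phi(\alpha)|\deg\phi = n$. *)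

(* Defs.v *)
From mathcomp Require Import all_boot all_order all_fingroup all_algebra.
From mathcomp Require Import all_classical all_reals all_analysis.

Set Implicit Arguments.
Unset Strict Implicit.
Unset Printing Implicit Defensive.

Import Order.TTheory GRing.Theory Num.Theory.
Import numFieldNormedType.Exports.
Local Open Scope classical_set_scope.
Local Open Scope ring_scope.

Section CyclicDecomposition.
Variables (F : finFieldType) (n : nat).
Implicit Types (alpha : 'M[F]_n) (s : seq ({poly F} * nat)).

Definition prime_power s (i : 'I_(size s)) : {poly F} :=
  let x := tnth (in_tuple s) i in x.1 ^+ x.2.

(* F^n, with z acting as alpha (on row vectors, v |-> v *m alpha), is isomorphic
   as an F[z]-module to the direct sum of the F[z]/(phi ^ a), (phi, a) in s. An
   F-linear map that commutes with the action of z is F[z]-linear.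
   {poly %/ p} is F[z]/(p) only for p monic and nonconstant, which the first
   clause guarantees. *)
Definition cyclic_decomposition alpha s : Prop :=
  (forall x, x \in s ->
     [/\ x.1 \is monic, irreducible_poly x.1 & (0 < x.2)%N]) /\
  exists f : 'rV[F]_n -> {dffun forall i : 'I_(size s), {poly %/ prime_power i}},
    [/\ bijective f,
        forall i, linear (fun v => f v i)
      & forall v i, f (v *m alpha) i = 'qX * f v i].

(* The parts of lambda_phi(alpha) in nonincreasing order. A decomposition exists
   and is unique up to the order of the summands, so the default [::] is never
   used and the result does not depend on the decomposition selected. *)
Definition lambda (phi : {poly F}) alpha : seq nat :=
  sort geq
    [seq x.2 | x <- xget [::] [set s | cyclic_decomposition alpha s]
             & x.1 == phi].

End CyclicDecomposition.

Definition largest_part (l : seq nat) : nat := (\max_(a <- l) a)%N.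

(* For n = 0 the type {'GL_n[F]} is that of 1 x 1 matrices; only n >= 1 is
   meaningful. *)
Definition prob_largest_part_lt (R : realType) (F : finFieldType)
    (phi : {poly F}) (k n : nat) : R :=
  #|[set g in 'GL_n[F]%g | (largest_part (lambda phi (GLval g)) < k)%N]%SET|%:R
  / #|'GL_n[F]%g|%:R.

(* For 0 <= u r <= 1 the partial products are nonincreasing and nonnegative, so
   the limit exists. *)
Definition infinite_product (R : realType) (P : pred nat) (u : nat -> R) : R :=
  limn (fun N => \prod_(1 <= r < N.+1 | P r) u r).

(* Main.v *)
Require Import Defs.
From HB Require Import structures.
From mathcomp Require Import all_boot all_order all_fingroup all_algebra.
From mathcomp Require Import ring lra zify.
From mathcomp Require Import all_classical all_reals all_analysis.

(** Write [m] for the degree of [phi], [x = q^-m] and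
    [(x)_n = (1 - x) ... (1 - x^n)].

    The largest part of [lambda_phi(alpha)] is less than [k] iff
    [phi(alpha)^k] and [phi(alpha)^(k-1)] have the same rank. Passing from
    [alpha] to the matrix it induces on the quotient by [ker phi(alpha)] shifts
    this sequence of ranks and removes the first column of [lambda_phi(alpha)].
    Counting the [alpha] with a given induced matrix [gamma] and
    [dim ker phi(alpha) = N m] (the counts are quotients of numbers of free
    tuples over the field [F[z]/(phi)]) gives, with
    [dim ker phi(gamma) = b m],

      Prob_n(N, lambda) = sum_b Prob_(n - N m)(b, shifted lambda)
                                x^(N^2) / (x)_(N-b).

    Without any condition on [lambda], this recursion and the fact that the
    probabilities sum to [1] determine the law of [N] for every [n]; as [n] tends
    to infinity, [Prob_n(N = 0)] tends to [(x)_oo]. With the condition, the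
    recursion is the Bailey chain started at the unit Bailey pair, so that
    the limit is the theta series [sum_r (-1)^r x^(k r^2 + r(r-1)/2)], [r] in Z,
    which is the product of the statement by the Jacobi triple product. *)

Set Implicit Arguments.
Unset Strict Implicit.
Unset Printing Implicit Defensive.
Import Order.TTheory GRing.Theory Num.Theory.
Import numFieldNormedType.Exports.
Local Open Scope ring_scope.

(** * Polynomials in a matrix *)

(** Without a condition, the recursion is an identity at [N = 0], hence the need for total mass [1].
    With the condition [stable_rank K.+1] its right side carries [stable_rank K], so that [K]
    decreases to [0], where the condition reads [N = 0] and the unconditional law applies. All
    identities are exact for finite [n]; limits and infinite sums are exchanged by domination, the
    probabilities having the majorant [4 x^N]. Since [q >= 2], [x <= 1/2] and [(x)_n >= 1/4], the
    source of the numerical constants. The count compares [alpha] and [gamma] through bases, so it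
    needs no class sizes or centralizers. The condition [phi <> z] enters as [phi(0) <> 0]: the
    block acting on [ker phi(alpha)] is then invertible, and [alpha] is invertible iff [gamma] is.
    The sum over [N] of the limits is evaluated by computing the limit of [(x)_L * bailey k L] in
    two ways, termwise in [N] and termwise in the theta series. *)

Section PolyOfMatrix.
Variable F : fieldType.

(* [horner_mx] requires a positive size, but the quotients below may have size 0. *)
Definition pmx n (A : 'M[F]_n) (p : {poly F}) : 'M[F]_n :=
  (if n is n'.+1 return 'M[F]_n -> 'M[F]_n then fun B => horner_mx B p
   else fun B => B) A.

Lemma pmx0 n (A : 'M[F]_n) : pmx A 0 = 0.
Proof. by case: n A => [|n] A; [rewrite !thinmx0 | rewrite /pmx rmorph0]. Qed.

Lemma pmxD n (A : 'M[F]_n) p r : pmx A (p + r) = pmx A p + pmx A r.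
Proof. by case: n A => [|n] A; [rewrite !thinmx0 | rewrite /pmx rmorphD]. Qed.

Lemma pmxN n (A : 'M[F]_n) p : pmx A (- p) = - pmx A p.
Proof. by case: n A => [|n] A; [rewrite !thinmx0 | rewrite /pmx rmorphN]. Qed.

Lemma pmxM n (A : 'M[F]_n) p r : pmx A (p * r) = pmx A p *m pmx A r.
Proof. by case: n A => [|n] A; [rewrite !thinmx0 | rewrite /pmx rmorphM]. Qed.

Lemma pmxC n (A : 'M[F]_n) c : pmx A c%:P = c%:M.
Proof. by case: n A => [|n] A; [rewrite !thinmx0 | rewrite /pmx horner_mx_C]. Qed.

Lemma pmx1 n (A : 'M[F]_n) : pmx A 1 = 1%:M.
Proof. exact: pmxC. Qed.

Lemma pmxX n (A : 'M[F]_n) : pmx A 'X = A.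
Proof. by case: n A => [|n] A; [rewrite !thinmx0 | rewrite /pmx horner_mx_X]. Qed.

Lemma pmxZ n (A : 'M[F]_n) c p : pmx A (c *: p) = c *: pmx A p.
Proof. by rewrite -mul_polyC pmxM pmxC mul_scalar_mx. Qed.

Lemma pmxMXaddC n (A : 'M[F]_n) p c : pmx A (p * 'X + c%:P) = pmx A p *m A + c%:M.
Proof. by rewrite pmxD pmxM pmxX pmxC. Qed.

Lemma pmx_comm n (A : 'M[F]_n) p r : pmx A p *m pmx A r = pmx A r *m pmx A p.
Proof. by rewrite -!pmxM mulrC. Qed.

Lemma pmx_commr n (A : 'M[F]_n) p : pmx A p *m A = A *m pmx A p.
Proof. by rewrite -{2 3}(pmxX A) pmx_comm. Qed.

Lemma pmx_sum n (A : 'M[F]_n) I (s : seq I) (P : pred I) (f : I -> {poly F}) :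
  pmx A (\sum_(i <- s | P i) f i) = \sum_(i <- s | P i) pmx A (f i).
Proof. exact: (big_morph _ (pmxD A) (pmx0 A)). Qed.

Lemma pmx_intertwine n1 n2 (A : 'M[F]_n1) (B : 'M[F]_n2) (f : 'M[F]_(n1, n2)) p :
  A *m f = f *m B -> pmx A p *m f = f *m pmx B p.
Proof.
move=> AfB; elim/poly_ind: p => [|p c IHp]; first by rewrite !pmx0 mul0mx mulmx0.
rewrite !pmxMXaddC mulmxDl mulmxDr -mulmxA AfB mulmxA IHp mulmxA.
by rewrite mul_scalar_mx mul_mx_scalar.
Qed.

Lemma pmx_conj n (g A : 'M[F]_n) p : g \in unitmx ->
  pmx (g *m A *m invmx g) p = g *m pmx A p *m invmx g.
Proof.
move=> g_unit; have := @pmx_intertwine _ _ (g *m A *m invmx g) A g p.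
rewrite mulmxKV // => /(_ erefl) <-; by rewrite mulmxK.
Qed.

Lemma mulmx_pmx_modp n k (A : 'M[F]_n) (Y : 'M[F]_(k, n)) phi p :
  Y *m pmx A phi = 0 -> Y *m pmx A (p %% phi) = Y *m pmx A p.
Proof.
move=> Yphi; rewrite [in RHS](divp_eq p phi) pmxD mulmxDr mulrC pmxM mulmxA.
by rewrite Yphi mul0mx add0r.
Qed.

End PolyOfMatrix.

(** * Companion matrices *)

Section Companion.
Variables (F : fieldType) (phi : {poly F}).
Hypotheses (phi_monic : phi \is monic) (phi_gt1 : (1 < size phi)%N).
Local Notation m := (size phi).-1.

Let m_gt0 : (0 < m)%N. Proof. by rewrite -ltnS (ltn_predK phi_gt1). Qed.

Lemma pmx_companionmx : pmx (companionmx phi) phi = 0.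
Proof.
have := companionmxK phi_monic; move: (companionmx phi).
case: m m_gt0 => // d _ A charA.
by rewrite /pmx -[X in horner_mx _ X]charA Cayley_Hamilton.
Qed.

Lemma companionmx_generates (p : {poly F}) : (size p <= m)%N ->
  poly_rV 1 *m pmx (companionmx phi) p = poly_rV p :> 'rV_m.
Proof.
have base j : (j < m)%N ->
    poly_rV 1 *m pmx (companionmx phi) 'X^j = poly_rV 'X^j :> 'rV_m.
  elim: j => [|j IHj] jm; first by rewrite expr0 pmx1 mulmx1.
  rewrite exprSr pmxM pmxX mulmxA IHj 1?ltnW //.
  have jm' : (j < m)%N by exact: ltnW.
  have polyrV_X (i : nat) (im : (i < m)%N) :
      poly_rV ('X^i : {poly F}) = delta_mx 0 (Ordinal im).
    by apply/rowP => l; rewrite !mxE coefXn eqxx /= -val_eqE.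
  rewrite -exprSr (polyrV_X _ jm) (polyrV_X _ jm').
  exact: (@mulmx_delta_companion _ phi (Ordinal jm')).
move=> pm; have pE : p = \sum_(i < m) p`_i *: 'X^i.
  rewrite -poly_def; apply/polyP => i; rewrite coef_poly.
  by case: ltnP => // mi; rewrite nth_default // (leq_trans pm).
rewrite [in LHS]pE pmx_sum mulmx_sumr [in RHS]pE.
rewrite linear_sum /=; apply: eq_bigr => i _.
by rewrite pmxZ -scalemxAr base // linearZ.
Qed.

Lemma rVpoly_mul_companionmx (v : 'rV_m) :
  rVpoly (v *m companionmx phi) = (rVpoly v * 'X) %% phi.
Proof.
have phi_neq0 : phi != 0 by rewrite monic_neq0.
have small r : (size (r %% phi)%R <= m)%N.
  by rewrite -ltnS (ltn_predK phi_gt1) ltn_modp.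
rewrite -{1}[v]rVpolyK -(companionmx_generates (size_poly _ _)) -mulmxA.
rewrite -{2}(pmxX (companionmx phi)) -pmxM -(mulmx_pmx_modp (phi := phi)).
  by rewrite companionmx_generates // poly_rV_K.
by rewrite pmx_companionmx mulmx0.
Qed.
End Companion.

(** * Free tuples over [F[z]/(phi)] *)

Section Tuples.
Variables (F : fieldType) (phi : {poly F}).
Hypotheses (phi_monic : phi \is monic) (phi_irr : irreducible_poly phi).
Local Notation m := (size phi).-1.

Let phi_gt1 : (1 < size phi)%N. Proof. by case: phi_irr. Qed.
Let m_gt0 : (0 < m)%N. Proof. by rewrite -ltnS (ltn_predK phi_gt1). Qed.
Let phi_neq0 : phi != 0. Proof. by rewrite monic_neq0. Qed.
Let size_modphi r : (size (r %% phi)%R <= m)%N.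
Proof. by rewrite -ltnS (ltn_predK phi_gt1) ltn_modp. Qed.

(** The rows of [c] are coefficient vectors of elements of [F[z]/(phi)]: once [phi(A)] kills [Y],
    this is a linear combination of the rows of [Y] over that field. *)
Definition module_comb n r (A : 'M[F]_n) (Y : 'M[F]_(r, n)) (c : 'M[F]_(r, m)) : 'rV_n :=
  \sum_i row i Y *m pmx A (rVpoly (row i c)).

Lemma module_comb_is_linear n r (A : 'M[F]_n) (Y : 'M[F]_(r, n)) :
  linear (module_comb A Y).
Proof.
move=> a c d; rewrite /module_comb scaler_sumr -big_split /=.
by apply: eq_bigr => i _; rewrite !linearP /= pmxD pmxZ mulmxDr -scalemxAr.
Qed.

HB.instance Definition _ n r (A : 'M[F]_n) (Y : 'M[F]_(r, n)) :=
  GRing.isLinear.Build F _ _ _ (module_comb A Y) (module_comb_is_linear A Y).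

(** Its rows are the [y A^j], for [y] a row of [Y] and [j < m]. *)
Definition orbit_mx n r (A : 'M[F]_n) (Y : 'M[F]_(r, n)) : 'M[F]_(r * m, n) :=
  lin1_mx (module_comb A Y \o vec_mx).

Lemma mul_orbit_mx n r (A : 'M[F]_n) (Y : 'M[F]_(r, n)) x :
  x *m orbit_mx A Y = module_comb A Y (vec_mx x).
Proof. by rewrite mul_rV_lin1. Qed.

Lemma mxvec_orbit_mx n r (A : 'M[F]_n) (Y : 'M[F]_(r, n)) c :
  mxvec c *m orbit_mx A Y = module_comb A Y c.
Proof. by rewrite mul_orbit_mx mxvecK. Qed.

(** The intertwining is required only behind [Y], because in [row_free_pmx_dl] the map commutes with
    the two actions only on [ker phi(G)]. *)
Lemma module_comb_intertwine n1 n2 r (A : 'M[F]_n1) (B : 'M[F]_n2)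
    (Y : 'M[F]_(r, n1)) (f : 'M[F]_(n1, n2)) c :
  (forall p, Y *m pmx A p *m f = Y *m f *m pmx B p) ->
  module_comb A Y c *m f = module_comb B (Y *m f) c.
Proof.
move=> YAf; rewrite /module_comb mulmx_suml; apply: eq_bigr => i _.
by rewrite -row_mul -row_mul YAf -row_mul row_mul -row_mul row_mul row_mul.
Qed.

Lemma module_comb_modp n r (A : 'M[F]_n) (Y : 'M[F]_(r, n)) c p :
  Y *m pmx A phi = 0 ->
  module_comb A Y c *m pmx A p =
  module_comb A Y (\matrix_i poly_rV ((rVpoly (row i c) * p) %% phi)).
Proof.
move=> Yphi; rewrite /module_comb mulmx_suml; apply: eq_bigr => i _.
rewrite rowK poly_rV_K // mulmx_pmx_modp -?mulmxA ?pmxM //.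
by rewrite -row_mul Yphi row0.
Qed.

Lemma module_comb_phi n r (A : 'M[F]_n) (Y : 'M[F]_(r, n)) c :
  Y *m pmx A phi = 0 -> module_comb A Y c *m pmx A phi = 0.
Proof.
move=> Yphi; rewrite /module_comb mulmx_suml big1 // => i _.
by rewrite -mulmxA pmx_comm mulmxA -row_mul Yphi row0 mul0mx.
Qed.

Lemma orbit_mx_freeP n r (A : 'M[F]_n) (Y : 'M[F]_(r, n)) :
  reflect (forall c, module_comb A Y c = 0 -> c = 0) (row_free (orbit_mx A Y)).
Proof.
apply: (iffP idP) => [freeS c c0|inj].
  apply/eqP; rewrite -(inj_eq (can_inj mxvecK)) linear0 -(mulmx_free_eq0 _ freeS).
  by rewrite mxvec_orbit_mx c0.
rewrite -kermx_eq0; apply/eqP/row_matrixP => i; rewrite row0.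
apply: (can_inj vec_mxK); rewrite linear0; apply: inj.
by rewrite -mul_orbit_mx -row_mul mulmx_ker row0.
Qed.

(** On [ker phi(A)], independence over the field [F[z]/(phi)] amounts to independence over [F] of
    the [r * m] vectors [y A^j]. *)
Definition free_tuple n r (A : 'M[F]_n) (Y : 'M[F]_(r, n)) :=
  (Y *m pmx A phi == 0) && row_free (orbit_mx A Y).

Lemma module_comb_col_mx n r (A : 'M[F]_n) (y : 'rV_n) (Y : 'M[F]_(r, n))
    (c : 'rV_m) (d : 'M[F]_(r, m)) :
  module_comb A (col_mx y Y) (col_mx c d) =
  y *m pmx A (rVpoly c) + module_comb A Y d.
Proof.
rewrite /module_comb big_split_ord /= big_ord1 !rowKu !row_id.
by congr (_ + _); apply: eq_bigr => i _; rewrite !rowKd.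
Qed.

(* [F[z]/(phi)] is a field, so a vector is free over a free tuple as soon as it
   lies outside its span. *)
Lemma free_tuple_col_mx n r (A : 'M[F]_n) (y : 'rV_n) (Y : 'M[F]_(r, n)) :
  free_tuple A (col_mx y Y) =
  free_tuple A Y && ((y *m pmx A phi == 0) && ~~ (y <= orbit_mx A Y)%MS).
Proof.
rewrite /free_tuple mul_col_mx col_mx_eq0.
have [yphi|_] := eqVneq (y *m pmx A phi) 0; last by rewrite andbF.
have [Yphi|_] := eqVneq (Y *m pmx A phi) 0; last by [].
rewrite /=; apply/orbit_mx_freeP/andP => [inj|[/orbit_mx_freeP injY yY] c].
  split; first apply/orbit_mx_freeP => d d0.
    have := inj (col_mx 0 d); rewrite module_comb_col_mx linear0 pmx0 mulmx0.
    by rewrite add0r => /(_ d0)/eqP; rewrite col_mx_eq0 => /andP[_ /eqP].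
  apply/negP => /submxP[x yx].
  have := inj (col_mx (poly_rV 1) (- vec_mx x)).
  rewrite module_comb_col_mx poly_rV_K ?size_poly1 // pmx1 mulmx1 linearN /=.
  rewrite -mul_orbit_mx -yx subrr => /(_ erefl)/eqP.
  rewrite col_mx_eq0 => /andP[/eqP/(congr1 rVpoly) + _].
  by rewrite poly_rV_K ?size_poly1 // linear0 => /eqP; rewrite oner_eq0.
rewrite -[c]vsubmxK module_comb_col_mx; set d := dsubmx c.
set p := rVpoly _ => /eqP; rewrite addr_eq0 => /eqP yp.
have p0 : p = 0.
  apply/eqP; apply: contraNT yY => p_neq0.
  have : coprimep phi p.
    have p_le : (size p <= m)%N by exact: size_poly.
    rewrite irreducible_poly_coprime //; apply/negP => /dvdp_leq - /(_ p_neq0).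
    by rewrite leqNgt -(ltn_predK phi_gt1) ltnS p_le.
  (* [v] inverts [p] modulo [phi]; this puts [y] in the span of [Y], against [yY]. *)
  case/Bezout_eq1_coprimepP => -[u v] /= uv1.
  have -> : y = - module_comb A Y d *m pmx A v.
    rewrite -yp -mulmxA -pmxM -[LHS]mulmx1 -(pmx1 A) -uv1 pmxD mulmxDr.
    by rewrite [u * _]mulrC (pmxM A phi) mulmxA yphi mul0mx add0r [v * _]mulrC.
  rewrite mulNmx eqmx_opp module_comb_modp //.
  by rewrite -mxvec_orbit_mx submxMl.
have d0 : d = 0.
  by apply: injY; apply/eqP; rewrite -oppr_eq0 -yp p0 pmx0 mulmx0.
by rewrite d0 -[usubmx c]rVpolyK -/p p0 linear0 col_mx0.
Qed.

Lemma orbit_mx_sub_ker n r (A : 'M[F]_n) (Y : 'M[F]_(r, n)) :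
  Y *m pmx A phi = 0 -> (orbit_mx A Y <= kermx (pmx A phi))%MS.
Proof.
move=> Yphi; apply/sub_kermxP/row_matrixP => i.
by rewrite row0 row_mul rowE mul_orbit_mx module_comb_phi.
Qed.
End Tuples.

(** * Numbers of free tuples and of completions to a basis *)

Section Counting.
Variable F : finFieldType.
Local Notation q := #|F|.

Lemma card_submx n k (W : 'M[F]_(k, n)) :
  #|[pred v : 'rV[F]_n | (v <= W)%MS]| = (q ^ \rank W)%N.
Proof.
have inj : injective (fun x : 'rV[F]_(\rank W) => x *m row_base W).
  by apply: row_free_inj; exact: row_base_free.
have := card_imset predT inj; rewrite card_mx mul1n => <-.
apply: eq_card => v; rewrite inE -(eq_row_base W).
apply/submxP/imsetP => [[x ->]|[x _ ->]]; by exists x.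
Qed.

Section Tuples.
Variable phi : {poly F}.
Hypotheses (phi_monic : phi \is monic) (phi_irr : irreducible_poly phi).
Local Notation m := (size phi).-1.

(** A new row must lie in [ker phi(A)] and outside the span of the rows already chosen, a subspace
    of this kernel of dimension [i * m] when there are [i] of them. *)
Lemma card_free_tuple n r (A : 'M[F]_n) :
  #|[pred Y : 'M[F]_(r, n) | free_tuple phi A Y]| =
  (\prod_(i < r) (q ^ (n - \rank (pmx A phi)) - q ^ (i * m)))%N.
Proof.
elim: r => [|r IHr].
  rewrite big_ord0; rewrite (eq_card (B := predT)); first by rewrite card_mx mul0n.
  move=> Y; rewrite !inE /free_tuple !flatmx0 eqxx /=.
  by apply/row_freeP; exists 0; rewrite !flatmx0.
rewrite big_ord_recr /= -IHr -[LHS]sum1_card -[X in (X * _)%N]sum1_card big_distrl /=.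
rewrite (reindex (fun z : 'rV[F]_n * 'M[F]_(r, n) =>
  col_mx z.1 z.2 : 'M[F]_(r.+1, n))) /=; last first.
  exists (fun Y : 'M[F]_(1 + r, n) => (usubmx Y, dsubmx Y)) => [[y Y] _|Y _] /=.
    by rewrite col_mxKu col_mxKd.
  by rewrite vsubmxK.
under eq_bigl => z do rewrite inE (free_tuple_col_mx phi_monic phi_irr) andbC.
rewrite -(pair_big_dep predT
  (fun y Y => (y *m pmx A phi == 0) && ~~ (y <= orbit_mx phi A Y)%MS
    && free_tuple phi A Y)
  (fun _ _ => 1%N)) /=.
rewrite (exchange_big_dep (free_tuple phi A)) /=; last by move=> y Y _ /andP[].
apply: eq_bigr => Y freeY; rewrite mul1n.
rewrite (eq_bigl
  [pred y | (y *m pmx A phi == 0) && ~~ (y <= orbit_mx phi A Y)%MS]); last first.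
  by move=> y; rewrite !inE freeY andbT.
case/andP: freeY => /eqP Yphi freeS.
have cS := card_submx (orbit_mx phi A Y); rewrite (eqP freeS) in cS.
have cK := card_submx (kermx (pmx A phi)); rewrite mxrank_ker in cK.
pose S := [pred v : 'rV[F]_n | (v <= orbit_mx phi A Y)%MS].
pose K := [pred v : 'rV[F]_n | (v <= kermx (pmx A phi))%MS].
have cI : #|[predI K & S]| = #|S|.
  apply: eq_card => y; rewrite !inE; apply/andP/idP => [[]//|yS]; split=> //.
  by apply: (submx_trans yS); exact: orbit_mx_sub_ker.
rewrite sum1_card -cS -cK -/S -/K -(cardID S K) cI addKn.
apply: eq_card => y; rewrite !inE andbC; congr (_ && _).
by apply/eqP/sub_kermxP.
Qed.

(** Existence is read off the count: free tuples exist as long as all factors of the product are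
    positive. *)
Lemma free_tuple_basis n (A : 'M[F]_n) :
  exists b (Z : 'M[F]_(b, n)), [/\ free_tuple phi A Z,
    (n - \rank (pmx A phi) = b * m)%N
    & (orbit_mx phi A Z :=: kermx (pmx A phi))%MS].
Proof.
have phi_gt1 : (1 < size phi)%N by case: phi_irr.
have m_gt0 : (0 < m)%N by rewrite -ltnS (ltn_predK phi_gt1).
have q_gt1 : (1 < q)%N by exact: card_finRing_gt1.
set d := (n - _)%N.
have exZ r : (forall i : 'I_r, i * m < d)%N -> exists Z : 'M[F]_(r, n), free_tuple phi A Z.
  move=> lt_d; suff /card_gt0P[Z] : (0 < #|[pred Y : 'M[F]_(r, n) | free_tuple phi A Y]|)%N.
    by rewrite inE => Zfree; exists Z.
  by rewrite card_free_tuple prodn_gt0 // => i; rewrite subn_gt0 ltn_exp2l.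
have le_d r (Z : 'M[F]_(r, n)) : free_tuple phi A Z -> (r * m <= d)%N.
  move=> /andP[/eqP Zphi /eqP rS].
  by have := mxrankS (orbit_mx_sub_ker Zphi); rewrite rS mxrank_ker.
have d_dvd : (m %| d)%N.
  (* If [m] did not divide [d], the factors up to [i = d %/ m] would all be positive, and a free
     tuple would span more than [d] dimensions. *)
  apply/negP => ndvd; have [i|Z /le_d] := exZ (d %/ m).+1.
    rewrite ltn_neqAle; apply/andP; split.
      by apply/eqP => dE; apply: ndvd; rewrite -dE dvdn_mull.
    by rewrite -leq_divRL // -ltnS.
  by rewrite leqNgt ltn_ceil.
have [i|Z Zfree] := exZ (d %/ m)%N; first by rewrite -ltn_divRL.
exists (d %/ m)%N, Z; split; rewrite ?divnK //.
case/andP: Zfree => /eqP Zphi /eqP rS.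
apply/eqmxP; rewrite -(geq_leqif (mxrank_leqif_eq (orbit_mx_sub_ker Zphi))).
by rewrite rS mxrank_ker divnK.
Qed.
End Tuples.

(** In coordinates where [S] is [(1 0)], the completions are the [(c d)] with [c] arbitrary and [d]
    invertible. *)
Lemma card_unitmx_completion u w (S : 'M[F]_(u, u + w)) : row_free S ->
  #|[pred B : 'M[F]_(w, u + w) | col_mx S B \in unitmx]| =
  (q ^ (w * u) * #|[pred d : 'M[F]_w | d \in unitmx]|)%N.
Proof.
move=> /eqP rS.
pose g := block_mx (col_ebase S) 0 0 1%:M *m row_ebase S.
have g_unit : g \in unitmx.
  rewrite unitmx_mul row_ebase_unit andbT unitmxE det_ublock det1 mulr1.
  by rewrite -unitmxE col_ebase_unit.
have SE : S = row_mx 1%:M 0 *m g.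
  rewrite /g mulmxA mul_row_block !mul1mx !mul0mx !addr0.
  rewrite -{1}(mulmx_ebase S) rS; congr (_ *m _).
  by rewrite pid_mx_row mul_mx_row mulmx1 mulmx0.
pose f (z : 'M[F]_(w, u) * 'M[F]_w) := row_mx z.1 z.2 *m g.
have f_bij : bijective f.
  exists (fun B => (lsubmx (B *m invmx g), rsubmx (B *m invmx g))) => [[c d]|B].
    by rewrite /f /= mulmxK // row_mxKl row_mxKr.
  by rewrite /f /= hsubmxK mulmxKV.
rewrite -(card_mx F w u) -cardX -(card_imset _ (bij_inj f_bij)).
apply: eq_card => B; rewrite inE; have [f' f'K fK'] := f_bij.
rewrite -[B]fK' (mem_imset _ _ (bij_inj f_bij)) !inE /=.
rewrite {1}SE -mul_col_mx unitmx_mul g_unit andbT.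
rewrite -[col_mx _ _]/(block_mx _ _ _ _) unitmxE det_lblock det1 mul1r.
by rewrite -unitmxE.
Qed.
End Counting.

(** * Block triangular matrices and sums of companion matrices *)

Lemma mulmx_rV_inj (R : pzSemiRingType) k n (A B : 'M[R]_(k, n)) :
  (forall x : 'rV_k, x *m A = x *m B) -> A = B.
Proof. by move=> eqAB; apply/row_matrixP => i; rewrite !rowE eqAB. Qed.

Section LowerBlock.
Variables (F : fieldType) (u w : nat).
Implicit Types (A : 'M[F]_u) (G : 'M[F]_w) (C : 'M[F]_(w, u)).

Definition pmx_dl A G C p : 'M[F]_(w, u) := dlsubmx (pmx (block_mx A 0 C G) p).

Lemma pmx_lower_block A G C p :
  pmx (block_mx A 0 C G) p = block_mx (pmx A p) 0 (pmx_dl A G C p) (pmx G p).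
Proof.
elim/poly_ind: p => [|p c IHp]; first
  by rewrite /pmx_dl !pmx0 -(block_mx0 F u w u w) block_mxKdl block_mx0.
rewrite /pmx_dl !pmxMXaddC IHp mulmx_block scalar_mx_block add_block_mx block_mxKdl.
by rewrite !(mul0mx, mulmx0, addr0, add0r).
Qed.

Lemma pmx_dlMXaddC A G C p c :
  pmx_dl A G C (p * 'X + c%:P) = pmx_dl A G C p *m A + pmx G p *m C.
Proof.
rewrite {1}/pmx_dl pmxMXaddC pmx_lower_block mulmx_block scalar_mx_block.
by rewrite add_block_mx block_mxKdl addr0.
Qed.

Lemma pmx_dl0 A G C : pmx_dl A G C 0 = 0.
Proof.
by rewrite /pmx_dl pmx0 -[X in dlsubmx X](block_mx0 F u w u w) block_mxKdl.
Qed.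

Lemma pmx_dlB A G p (C1 C2 : 'M[F]_(w, u)) :
  pmx_dl A G (C1 - C2) p = pmx_dl A G C1 p - pmx_dl A G C2 p.
Proof.
elim/poly_ind: p => [|p c IHp]; first by rewrite !pmx_dl0 subrr.
by rewrite !pmx_dlMXaddC IHp mulmxBl mulmxBr opprD addrACA.
Qed.

Lemma pmx_dl_comm A G C p :
  G *m pmx_dl A G C p + C *m pmx A p = pmx_dl A G C p *m A + pmx G p *m C.
Proof.
have := pmx_commr (block_mx A 0 C G) p.
rewrite pmx_lower_block !mulmx_block => /eq_block_mx[_ _ + _].
by rewrite addrC => ->; rewrite addrC.
Qed.

Lemma rank_pmx_lower_block A G C p : pmx A p = 0 ->
  (\rank (pmx (block_mx A 0 C G) p) == w) = row_free (row_mx (pmx_dl A G C p) (pmx G p)).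
Proof.
move=> Ap; rewrite pmx_lower_block Ap /row_free.
by rewrite /block_mx row_mx0 rank_col_0mx.
Qed.

(** The power [i + 1] of [p(M)], [M] the block matrix, has zero top rows and bottom rows [p(G)^i H],
    where [H] consists of the bottom rows of [p(M)]. The rank hypothesis makes [H] row free, so it
    can be cancelled. *)
Lemma rank_pmx_lower_block_exp A G C p i : pmx A p = 0 ->
  \rank (pmx (block_mx A 0 C G) p) = w ->
  \rank (pmx (block_mx A 0 C G) (p ^+ i.+1)) = \rank (pmx G (p ^+ i)).
Proof.
move=> Ap /eqP; rewrite rank_pmx_lower_block //; set H := row_mx _ _ => freeH.
have powE j : pmx (block_mx A 0 C G) (p ^+ j.+1) = col_mx 0 (pmx G (p ^+ j) *m H).
  elim: j => [|j IHj].
    rewrite expr1 expr0 pmx1 mul1mx pmx_lower_block Ap.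
    by rewrite /block_mx row_mx0.
  rewrite exprSr pmxM IHj mul_col_mx mul0mx; congr col_mx.
  rewrite pmx_lower_block Ap exprSr pmxM -!mulmxA; congr (_ *m _).
  by rewrite /H mul_row_block !mulmx0 !add0r mul_mx_row.
by rewrite powE rank_col_0mx mxrankMfree.
Qed.

End LowerBlock.

(** Writing [p = p' z + c] with [c <> 0], the inverse of [A] is [- c^-1 p'(A)]. *)
Lemma unitmx_annihilated (F : fieldType) n (A : 'M[F]_n) p :
  pmx A p = 0 -> p.[0] != 0 -> A \in unitmx.
Proof.
elim/poly_ind: p => [|p c _]; first by rewrite horner0 eqxx.
rewrite hornerMXaddC mulr0 add0r pmxMXaddC => /eqP; rewrite addr_eq0 => /eqP pA c0.
suff : (- c^-1) *: pmx A p *m A = 1%:M by case/mulmx1_unit.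
by rewrite -scalemxAl pA scaleNr scalerN opprK scale_scalar_mx mulVf.
Qed.

Section CompanionSum.
Variables (F : fieldType) (phi : {poly F}).
Hypotheses (phi_monic : phi \is monic) (phi_irr : irreducible_poly phi).
Local Notation m := (size phi).-1.
Let phi_gt1 : (1 < size phi)%N. Proof. by case: phi_irr. Qed.
Let m_gt0 : (0 < m)%N. Proof. by rewrite -ltnS (ltn_predK phi_gt1). Qed.

(** Multiplication by [z] on [(F[z]/(phi))^N], whose elements are [N] by [m] coefficient matrices
    flattened by [mxvec]. The rows of [companion_sum_gen] are the standard generators. *)
Definition companion_sum N : 'M[F]_(N * m) := lin_mulmxr (companionmx phi).

Definition companion_sum_gen N : 'M[F]_(N, N * m) :=
  \matrix_i mxvec (delta_mx i 0 *m poly_rV 1).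

Lemma mxvec_pmx_companion_sum N (c : 'M[F]_(N, m)) p :
  mxvec c *m pmx (companion_sum N) p = mxvec (c *m pmx (companionmx phi) p).
Proof.
elim/poly_ind: p => [|p a IHp]; first by rewrite !pmx0 !mulmx0 linear0.
rewrite !pmxMXaddC !mulmxDr !mulmxA IHp mul_vec_lin /= linearD /=.
by rewrite !mul_mx_scalar linearZ.
Qed.

Lemma pmx_companion_sum N : pmx (companion_sum N) phi = 0.
Proof.
apply: mulmx_rV_inj => x; rewrite -[x]vec_mxK mxvec_pmx_companion_sum.
by rewrite pmx_companionmx // !mulmx0 linear0.
Qed.

Lemma orbit_mx_companion_sum n N (A : 'M[F]_n) (Y : 'M[F]_(N, n)) :
  Y *m pmx A phi = 0 ->
  orbit_mx phi A Y *m A = companion_sum N *m orbit_mx phi A Y.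
Proof.
move=> Yphi; apply: mulmx_rV_inj => x; rewrite -[x]vec_mxK; move: (vec_mx x) => c.
rewrite !mulmxA mul_vec_lin !mxvec_orbit_mx /= -{2}(pmxX A) module_comb_modp //.
congr (module_comb _ _ _); apply/row_matrixP => i; rewrite rowK row_mul.
by rewrite -rVpoly_mul_companionmx // rVpolyK.
Qed.

(** A module map out of [(F[z]/(phi))^N] is determined by the images of the generators. With
    [generator_orbit_mx], this lets a tuple [Y] and the matrix of its orbit be recovered from each
    other. *)
Lemma orbit_mx_generator n N (A : 'M[F]_n) (G : 'M[F]_(N * m, n)) :
  companion_sum N *m G = G *m A ->
  orbit_mx phi A (companion_sum_gen N *m G) = G.
Proof.
move=> GA; apply: mulmx_rV_inj => x; rewrite -[x]vec_mxK; move: (vec_mx x) => c.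
rewrite mxvec_orbit_mx -(module_comb_intertwine (A := companion_sum N)); last first.
  by move=> p; rewrite -!mulmxA (pmx_intertwine p GA).
congr (_ *m _); rewrite /module_comb.
under eq_bigr => i _ do rewrite rowK mxvec_pmx_companion_sum -mulmxA
  companionmx_generates ?size_poly // rVpolyK.
rewrite -linear_sum; congr mxvec; apply/row_matrixP => i.
rewrite linear_sum (bigD1 i) //= big1 ?addr0 => [|j ji].
  by rewrite row_mul [row i (delta_mx _ _)]rowE mul_delta_mx -rowE row_id.
by rewrite row_mul [row i (delta_mx _ _)]rowE mul_delta_mx_0 ?mul0mx // eq_sym.
Qed.

Lemma generator_orbit_mx n N (A : 'M[F]_n) (Y : 'M[F]_(N, n)) :
  companion_sum_gen N *m orbit_mx phi A Y = Y.
Proof.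
apply/row_matrixP => i; rewrite row_mul rowK mxvec_orbit_mx /module_comb.
rewrite (bigD1 i) //= big1 ?addr0 => [|j ji].
  rewrite row_mul [row i (delta_mx _ _)]rowE mul_delta_mx -rowE row_id poly_rV_K ?size_poly1 //.
  by rewrite pmx1 mulmx1.
by rewrite row_mul [row j (delta_mx _ _)]rowE mul_delta_mx_0 // mul0mx linear0 pmx0 mulmx0.
Qed.
End CompanionSum.

Lemma card_preim_additive (A B : finZmodType) (f : A -> B) (P : pred B) :
    {morph f : x y / x - y} -> (forall b, exists a, f a = b) ->
  (#|[pred a | P (f a)]| * #|B| = #|P| * #|A|)%N.
Proof.
move=> fB f_surj; set c := #|[pred a | f a == 0]|.
have fN x : f (- x) = - f x by rewrite -sub0r fB -{1}(subrr 0) fB subrr sub0r.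
have fiber b : (\sum_(a | f a == b) 1 = c)%N.
  have [a0 fa0] := f_surj b.
  rewrite sum1_card /c -(fintype.card_image (f := fun a => a - a0)); last first.
    by move=> x y /addIr.
  apply: eq_card => a; rewrite [RHS]inE; apply/fintype.imageP/eqP => [[x + ->]|fa].
    by rewrite fB fa0 unfold_in => /eqP ->; rewrite subrr.
  exists (a + a0); last by rewrite addrK.
  by apply/eqP; rewrite -[a0]opprK fB fN opprK fa add0r fa0.
have cardA : #|A| = (#|B| * c)%N.
  rewrite -sum1_card (partition_big f predT) //= (eq_bigr (fun=> c)).
    by rewrite sum_nat_const.
  by move=> b _; exact: fiber.
have -> : #|[pred a | P (f a)]| = (#|P| * c)%N.
  rewrite -sum1_card (partition_big f P) //= (eq_bigr (fun=> c)).
    by rewrite sum_nat_const.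
  move=> b Pb; rewrite -(fiber b); apply: eq_bigl => a; rewrite inE.
  by apply/andP/eqP => [[_ /eqP]//|ab]; rewrite ab Pb eqxx.
by rewrite cardA -mulnA [(c * _)%N]mulnC.
Qed.

(** * Block triangular extensions of a given quotient matrix *)

Section Extension.
Variables (F : finFieldType) (phi : {poly F}).
Hypotheses (phi_monic : phi \is monic) (phi_irr : irreducible_poly phi).
Local Notation m := (size phi).-1.
Local Notation q := #|F|.
Let phi_gt1 : (1 < size phi)%N. Proof. by case: phi_irr. Qed.
Let m_gt0 : (0 < m)%N. Proof. by rewrite -ltnS (ltn_predK phi_gt1). Qed.

(* The top coefficient of [phi] being [1], [Z G^(m-1) C] occurs with
   coefficient [1] in the image of [C], and it can be prescribed freely. *)
Lemma pmx_dl_surj u w b (D : 'M[F]_u) (G : 'M[F]_w) (Z : 'M[F]_(b, w)) :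
  row_free (orbit_mx phi G Z) ->
  forall T : 'M[F]_(b, u), exists C, Z *m pmx_dl D G C phi = T.
Proof.
move=> freeS T; set S := orbit_mx phi G Z in freeS.
have last_lt : (m.-1 < m)%N by rewrite ltn_predL.
pose last := Ordinal last_lt.
pose f (x : 'rV[F]_(b * m)) : 'rV[F]_u := (col last (vec_mx x))^T *m T.
have f_lin : linear f.
  by move=> a x y; rewrite /f !linearP /= mulmxDl -scalemxAl.
pose fL := GRing.isLinear.Build F _ _ _ f f_lin.
pose f' : {linear 'rV[F]_(b * m) -> 'rV[F]_u} := HB.pack f fL.
(* On the row space of [S], [C] reads the coefficients of [z^(m-1)] and applies them to [T];
   [pinvmx] extends it to all of [F^w]. *)
pose C := pinvmx S *m lin1_mx f'.
have ZpC (p : {poly F}) : (size p <= m)%N -> Z *m pmx G p *m C = p`_m.-1 *: T.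
  move=> pm; apply/row_matrixP => i.
  have -> : row i (Z *m pmx G p *m C) = mxvec (delta_mx i 0 *m poly_rV p) *m S *m C.
    rewrite mxvec_orbit_mx row_mul; congr (_ *m _); rewrite row_mul /module_comb.
    rewrite (bigD1 i) //= big1 ?addr0 => [|j ji].
      rewrite row_mul [row i (delta_mx _ _)]rowE mul_delta_mx -rowE row_id.
      by rewrite poly_rV_K.
    rewrite row_mul [row j (delta_mx _ _)]rowE mul_delta_mx_0 // mul0mx linear0.
    by rewrite pmx0 mulmx0.
  rewrite /C mulmxA mulmxKp // mul_rV_lin1 /= /f mxvecK.
  have -> : (col last (delta_mx i 0 *m poly_rV p))^T = p`_m.-1 *: delta_mx 0 i.
    by apply/rowP => j; rewrite !mxE big_ord1 !mxE eqxx andbT /= mulrC.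
  by rewrite -scalemxAl -rowE linearZ.
clearbody C; exists C.
(* Size [m + 1] is that of [phi]. In the induction step [p] has size at most [m], so [p_m = 0]
   removes the first term of [pmx_dlMXaddC], and [ZpC] evaluates the second. *)
suff dlE (p : {poly F}) : (size p <= m.+1)%N -> Z *m pmx_dl D G C p = p`_m *: T.
  rewrite dlE ?(ltn_predK phi_gt1) //.
  by move: phi_monic; rewrite monicE lead_coefE => /eqP ->; rewrite scale1r.
elim/poly_ind: p => [_|p c IHp]; first by rewrite pmx_dl0 mulmx0 coef0 scale0r.
have [->|p_neq0] := eqVneq p 0.
  rewrite mul0r add0r coefC => _; rewrite -[c%:P]add0r -(mul0r 'X).
  by rewrite pmx_dlMXaddC pmx_dl0 pmx0 !mul0mx addr0 mulmx0 gtn_eqF // scale0r.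
rewrite size_MXaddC (negbTE p_neq0) /= ltnS => pm.
rewrite pmx_dlMXaddC mulmxDr !mulmxA IHp ?(leq_trans pm) // ZpC //.
rewrite [p`_m]nth_default // scale0r mul0mx add0r coefD coefMX coefC.
by rewrite gtn_eqF // addr0.
Qed.

(** A vector killed by the row block lies in [ker phi(G)], the span of [Z]. There
    [E = pmx_dl D G C phi] commutes with the action of [z], so injectivity on this span means that
    the images [Z E] are free. *)
Lemma row_free_pmx_dl u w b (D : 'M[F]_u) (G : 'M[F]_w) (Z : 'M[F]_(b, w)) C :
    pmx D phi = 0 -> free_tuple phi G Z ->
    (orbit_mx phi G Z :=: kermx (pmx G phi))%MS ->
  row_free (row_mx (pmx_dl D G C phi) (pmx G phi)) =
  free_tuple phi D (Z *m pmx_dl D G C phi).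
Proof.
move=> Dphi /andP[/eqP Zphi freeS] SK; rewrite /free_tuple Dphi mulmx0 eqxx /=.
set E := pmx_dl D G C phi.
have ZE p : Z *m pmx G p *m E = Z *m E *m pmx D p.
  elim/poly_ind: p => [|p c IHp]; first by rewrite !pmx0 mulmx0 mul0mx mulmx0.
  rewrite !pmxMXaddC !mulmxDr mulmxDl; congr (_ + _); last first.
    by rewrite !mul_mx_scalar -scalemxAl.
  have := pmx_dl_comm D G C phi; rewrite Dphi mulmx0 addr0 -/E => GE.
  rewrite !mulmxA -(mulmxA (Z *m _) G) GE mulmxDr mulmxA IHp !mulmxA.
  by rewrite -(mulmxA Z (pmx G p)) pmx_comm mulmxA Zphi !mul0mx addr0.
apply/idP/orbit_mx_freeP => [freeH c c0|inj].
  have v0 : module_comb G Z c = 0.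
    apply/eqP; rewrite -(mulmx_free_eq0 _ freeH) mul_mx_row module_comb_phi //.
    by rewrite (module_comb_intertwine (B := D)) // c0 row_mx0.
  by move/orbit_mx_freeP: freeS; apply.
rewrite -kermx_eq0; apply/eqP/row_matrixP => i; rewrite row0.
have: row i (kermx (row_mx E (pmx G phi))) *m row_mx E (pmx G phi) = 0.
  by rewrite -row_mul mulmx_ker row0.
move: (row i _) => v; rewrite mul_mx_row => /eqP; rewrite row_mx_eq0.
case/andP=> /eqP vE /eqP vphi.
have /submxP[x vx] : (v <= orbit_mx phi G Z)%MS by rewrite SK; apply/sub_kermxP.
rewrite vx mul_orbit_mx in vE *.
rewrite (inj (vec_mx x)) ?linear0 //.
by rewrite -(module_comb_intertwine (A := G)).
Qed.

(** [C] is admissible iff its image under the additive surjection of [pmx_dl_surj] is a free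
    [b]-tuple for [D]. As [phi(D) = 0], these tuples are counted in all of [F^u]. *)
Lemma card_extensions u w b (D : 'M[F]_u) (G : 'M[F]_w) : pmx D phi = 0 ->
    (w - \rank (pmx G phi) = b * m)%N ->
  (#|[pred C | \rank (pmx (block_mx D 0 C G) phi) == w]| * q ^ (b * u) =
   \prod_(i < b) (q ^ u - q ^ (i * m)) * q ^ (w * u))%N.
Proof.
move=> Dphi; have [b' [Z [Zfree bE SK]]] := free_tuple_basis phi_monic phi_irr G.
rewrite bE => /eqP; rewrite eqn_pmul2r // => /eqP b'E; subst b'.
have := card_free_tuple phi_monic phi_irr b D; rewrite Dphi mxrank0 subn0 => <-.
rewrite -(card_mx F b u) -(card_mx F w u).
have := @card_preim_additive 'M[F]_(w, u) 'M[F]_(b, u)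
  (fun C => Z *m pmx_dl D G C phi) [pred Y | free_tuple phi D Y].
move=> <- //=.
- congr (_ * _)%N; apply: eq_card => C; rewrite !inE rank_pmx_lower_block //.
  exact: row_free_pmx_dl.
- by move=> C1 C2; rewrite pmx_dlB mulmxBr.
- by move=> T; apply: pmx_dl_surj; case/andP: Zfree.
Qed.
End Extension.

(** * Counting by the kernel of [phi(alpha)] *)

Definition rank_seq (F : fieldType) (phi : {poly F}) n (A : 'M[F]_n) : nat -> nat :=
  fun i => \rank (pmx A (phi ^+ i)).

Definition gl_order (F : finFieldType) n := #|[pred A : 'M[F]_n | A \in unitmx]|.

Lemma rank_seq_conj (F : fieldType) (phi : {poly F}) n (g A : 'M[F]_n) :
  g \in unitmx -> rank_seq phi (g *m A *m invmx g) = rank_seq phi A.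
Proof.
move=> g_unit; apply/funext => i; rewrite /rank_seq pmx_conj //.
by rewrite mxrankMfree ?row_free_unit ?unitmx_inv // eqmxMfull // row_full_unit.
Qed.

Section DoubleCount.
Variables (F : finFieldType) (phi : {poly F}).
Hypotheses (phi_monic : phi \is monic) (phi_irr : irreducible_poly phi).
Hypothesis phi0_neq0 : phi.[0] != 0.
Local Notation m := (size phi).-1.
Local Notation q := #|F|.

Variables (V : nmodType) (H : (nat -> nat) -> V) (N w : nat).
Local Notation u := (N * m)%N.
Local Notation Delta := (companion_sum phi N).
Local Notation triple := ('M[F]_(u + w) * ('M[F]_(N, u + w) * 'M[F]_(w, u + w)))%type.
Local Notation framed := ('M[F]_(u + w) * ('M[F]_w * 'M[F]_(w, u)))%type.

(** By the rank condition [ker phi(A)] has dimension [u = N m], so a free [N]-tuple spans it. *)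
Let is_triple (t : triple) :=
  ((t.1 \in unitmx) && (\rank (pmx t.1 phi) == w)) &&
  (free_tuple phi t.1 t.2.1 && (col_mx (orbit_mx phi t.1 t.2.1) t.2.2 \in unitmx)).

Let lower (C : 'M[F]_(w, u)) (G : 'M[F]_w) : 'M[F]_(u + w) := block_mx Delta 0 C G.

Let is_framed (f : framed) :=
  (f.1 \in unitmx) && ((f.2.1 \in unitmx) && (\rank (pmx (lower f.2.2 f.2.1) phi) == w)).

Let to_triple (f : framed) : triple :=
  let: (g, (G, C)) := f in
  (invmx g *m lower C G *m g, (companion_sum_gen phi N *m usubmx g, dsubmx g)).

Let of_triple (t : triple) : framed :=
  let: (A, (Y, B)) := t in
  let g := col_mx (orbit_mx phi A Y) B in
  let M := g *m A *m invmx g in (g, (drsubmx M, dlsubmx M)).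

Let lower_unit C G : (lower C G \in unitmx) = (G \in unitmx).
Proof.
rewrite /lower !unitmxE det_lblock unitrM -!unitmxE.
by rewrite (unitmx_annihilated (pmx_companion_sum phi_monic phi_irr N)).
Qed.

Let of_tripleK t : is_triple t -> to_triple (of_triple t) = t.
Proof.
case: t => A [Y B] /andP[/= _ /andP[/andP[/eqP Yphi _] g_unit]].
set g := col_mx _ B in g_unit *; set M := g *m A *m invmx g.
have -> : lower (dlsubmx M) (drsubmx M) = M.
  rewrite -[RHS]submxK /lower; have : usubmx M = row_mx Delta 0.
    apply: (can_inj (mulmxK g_unit)); rewrite -mul_usub_mx /M mulmxKV //.
    rewrite mul_col_mx col_mxKu orbit_mx_companion_sum //.
    by rewrite mul_row_col mul0mx addr0.
  by rewrite /ulsubmx /ursubmx => ->; rewrite row_mxKl row_mxKr.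
rewrite /M !mulmxA mulVmx // mul1mx mulmxKV // /g col_mxKu col_mxKd.
by rewrite generator_orbit_mx.
Qed.

(** The left side is the index condition produced by [reindex_onto]. For a framed [f], the top [u]
    rows of [g] intertwine [Delta] with [A], so [orbit_mx_generator] recovers them from the images
    of the generators. *)
Let is_framedE f : is_triple (to_triple f) && (of_triple (to_triple f) == f) = is_framed f.
Proof.
case: f => g [G C]; rewrite /to_triple /of_triple /is_triple /is_framed /=.
set A := invmx g *m _ *m g; set Y := _ *m usubmx g.
set g' := col_mx _ _.
apply/andP/idP => [[/andP[/andP[A_unit rA] /andP[_ g'_unit]] /eqP[g'g _ _]]|].
  have g_unit : g \in unitmx by rewrite -g'g.
  rewrite g_unit /=.
  have LE : lower C G = g *m A *m invmx g by rewrite /A !mulmxA mulmxV // mul1mx mulmxK.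
  rewrite -(lower_unit C G) LE 2!unitmx_mul unitmx_inv g_unit A_unit /=.
  rewrite pmx_conj // mxrankMfree ?row_free_unit ?unitmx_inv //.
  by rewrite eqmxMfull // row_full_unit.
case/andP=> g_unit /andP[G_unit rL].
have LE : lower C G = g *m A *m invmx g by rewrite /A !mulmxA mulmxV // mul1mx mulmxK.
have gA : g *m A = lower C G *m g by rewrite LE mulmxKV.
have DG : Delta *m usubmx g = usubmx g *m A.
  rewrite mul_usub_mx gA -{2}[g]vsubmxK /lower mul_block_col col_mxKu.
  by rewrite mul0mx addr0.
have SE : orbit_mx phi A Y = usubmx g by exact: orbit_mx_generator.
have g'E : g' = g by rewrite /g' SE vsubmxK.
rewrite g'E g_unit -LE /lower block_mxKdr block_mxKdl eqxx.
split=> //; rewrite andbT.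
have -> /= : A \in unitmx.
  by rewrite /A !unitmx_mul unitmx_inv g_unit lower_unit G_unit.
have -> /= : \rank (pmx A phi) == w.
  move: rL; rewrite LE pmx_conj // mxrankMfree ?row_free_unit ?unitmx_inv //.
  by rewrite eqmxMfull // row_full_unit.
rewrite /free_tuple /Y -mulmxA -(pmx_intertwine _ DG) pmx_companion_sum //.
rewrite mul0mx mulmx0 eqxx /= -/Y SE -kermx_eq0; apply/eqP.
apply: mulmx_rV_inj => x; rewrite mulmx0; set y := x *m _.
have y0 : row_mx y 0 *m g = 0.
  by rewrite -{1}[g]vsubmxK mul_row_col mul0mx addr0 /y -mulmxA mulmx_ker mulmx0.
have := congr1 (mulmx^~ (invmx g)) y0; rewrite mulmxK // mul0mx => /eqP.
by rewrite row_mx_eq0 => /andP[/eqP].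
Qed.

(* Both sides count pairs [(alpha, g)] with [g] a basis whose first [N m] rows
   are the [y alpha^j], [y] in a free tuple spanning [ker phi(alpha)]: in the
   basis [g], the matrix [alpha] becomes block triangular, with upper left block
   [Delta]. *)
Lemma sum_rank_seq_kernel :
  (\sum_(A : 'M[F]_(u + w) | (A \in unitmx) && (\rank (pmx A phi) == w))
     H (fun i => rank_seq phi A i.+1)) *+
    (\prod_(i < N) (q ^ u - q ^ (i * m)) * (q ^ (w * u) * gl_order F w)) =
  \sum_(G : 'M[F]_w | G \in unitmx) H (rank_seq phi G) *+
    (gl_order F (u + w) *
     #|[pred C | \rank (pmx (block_mx Delta 0 C G) phi) == w]|).
Proof.
transitivity (\sum_(t | is_triple t) H (fun i => rank_seq phi t.1 i.+1)).
  rewrite -(pair_big_dep (fun A : 'M[F]_(u + w) => (A \in unitmx) && (\rank (pmx A phi) == w))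
    (fun (A : 'M[F]_(u + w)) (z : 'M[F]_(N, u + w) * 'M[F]_(w, u + w)) =>
      free_tuple phi A z.1 && (col_mx (orbit_mx phi A z.1) z.2 \in unitmx))
    (fun A _ => H (fun i => rank_seq phi A i.+1))) /=.
  rewrite -sumrMnl; apply: eq_bigr => A /andP[_ /eqP rA].
  rewrite -(pair_big_dep (fun Y : 'M[F]_(N, u + w) => free_tuple phi A Y)
    (fun Y (B : 'M[F]_(w, u + w)) => col_mx (orbit_mx phi A Y) B \in unitmx)
    (fun _ _ => H (fun i => rank_seq phi A i.+1))) /=.
  rewrite (eq_bigr (fun=> H (fun i => rank_seq phi A i.+1) *+ (q ^ (w * u) * gl_order F w))).
    rewrite sumr_const -mulrnA; congr (_ *+ _); rewrite [RHS]mulnC; congr (_ * _)%N.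
    by have := card_free_tuple phi_monic phi_irr N A; rewrite rA addnK => <-.
  move=> Y /andP[_ freeS]; rewrite sumr_const; congr (_ *+ _).
  exact: card_unitmx_completion.
rewrite (reindex_onto to_triple of_triple) //=.
rewrite (eq_bigl _ _ is_framedE).
rewrite (eq_bigr (fun f => H (rank_seq phi f.2.1))); last first.
  case=> g [G C] /andP[/= g_unit /andP[G_unit /eqP rL]]; congr H.
  rewrite -{2}[g]invmxK rank_seq_conj ?unitmx_inv //; apply/funext => i.
  by apply: rank_pmx_lower_block_exp => //; exact: pmx_companion_sum.
rewrite -(pair_big (fun g : 'M[F]_(u + w) => g \in unitmx)
  (fun z : 'M[F]_w * 'M[F]_(w, u) => (z.1 \in unitmx) && (\rank (pmx (lower z.2 z.1) phi) == w))
  (fun _ z => H (rank_seq phi z.1))) /= sumr_const -/(gl_order F (u + w)).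
rewrite -(pair_big_dep (fun G : 'M[F]_w => G \in unitmx)
  (fun G C => \rank (pmx (lower C G) phi) == w)
  (fun G _ => H (rank_seq phi G))) /= -sumrMnl; apply: eq_bigr => G G_unit.
by rewrite sumr_const -mulrnA; congr (_ *+ _); rewrite [LHS]mulnC.
Qed.
End DoubleCount.

(** * Finite q-series identities *)

Section QSeries.
Variables (R : realFieldType) (x : R).
Hypotheses (x_gt0 : 0 < x) (x_lt1 : x < 1).

Definition qpoch n : R := \prod_(i < n) (1 - x ^+ i.+1).

Lemma qpoch0 : qpoch 0 = 1. Proof. by rewrite /qpoch big_ord0. Qed.

Lemma qpochS n : qpoch n.+1 = qpoch n * (1 - x ^+ n.+1).
Proof. by rewrite /qpoch big_ord_recr. Qed.

Lemma onem_expr_gt0 n : 0 < 1 - x ^+ n.+1.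
Proof. by rewrite subr_gt0 exprn_ilt1 // ltW. Qed.

Lemma qpoch_gt0 n : 0 < qpoch n.
Proof. by apply: prodr_gt0 => i _; exact: onem_expr_gt0. Qed.

Lemma qpoch_neq0 n : qpoch n != 0.
Proof. by rewrite gt_eqF ?qpoch_gt0. Qed.

Lemma qpoch_le1 n : qpoch n <= 1.
Proof.
elim: n => [|n IHn]; first by rewrite qpoch0.
rewrite qpochS mulr_ile1 // ltW ?qpoch_gt0 ?onem_expr_gt0 //.
by rewrite gtrBl exprn_gt0.
Qed.

Lemma qpoch_nonincreasing i j : (i <= j)%N -> qpoch j <= qpoch i.
Proof.
move=> /subnK <-; elim: (j - i)%N => // d IHd; rewrite addSn qpochS.
apply: le_trans IHd; rewrite ler_piMr // ltW ?qpoch_gt0 //.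
by rewrite gtrBl exprn_gt0.
Qed.

Definition qbin n j : R := if (j <= n)%N then qpoch n / (qpoch j * qpoch (n - j)) else 0.

Lemma qbin_add j k : qbin (j + k) j = qpoch (j + k) / (qpoch j * qpoch k).
Proof. by rewrite /qbin leq_addr addKn. Qed.

Lemma qbin0 n : qbin n 0 = 1.
Proof. by rewrite /qbin subn0 qpoch0 mul1r divff ?qpoch_neq0. Qed.

Lemma qbin_small n j : (n < j)%N -> qbin n j = 0.
Proof. by move=> nj; rewrite /qbin leqNgt nj. Qed.

Lemma qbinn n : qbin n n = 1.
Proof. by rewrite /qbin leqnn subnn qpoch0 mulr1 divff ?qpoch_neq0. Qed.

Let oneB_neq0 n : 1 - x ^+ n.+1 != 0.
Proof. by rewrite gt_eqF ?onem_expr_gt0. Qed.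

Lemma qbin_pascal n j : qbin n.+1 j.+1 = qbin n j.+1 + x ^+ (n - j) * qbin n j.
Proof.
case: (ltngtP j n) => [jn|nj|->].
- have [k nE] : exists k, n = (j + k.+1)%N by exists (n - j.+1)%N; lia.
  have -> : (n - j = k.+1)%N by lia.
  have -> : qbin n.+1 j.+1 = qpoch n.+1 / (qpoch j.+1 * qpoch k.+1).
    by rewrite nE -addSn qbin_add.
  have -> : qbin n j.+1 = qpoch n / (qpoch j.+1 * qpoch k).
    by rewrite nE addnS -addSn qbin_add.
  have -> : qbin n j = qpoch n / (qpoch j * qpoch k.+1) by rewrite nE qbin_add.
  have xE : x ^+ n.+1 = x ^+ j.+1 * x ^+ k.+1 by rewrite -exprD; congr (_ ^+ _); lia.
  rewrite !qpochS xE; have := oneB_neq0 j; have := oneB_neq0 k.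
  move: (x ^+ j.+1) (x ^+ k.+1) => a b b1 a1.
  field; rewrite ?qpoch_neq0 ?a1 ?b1 //.
- by rewrite !qbin_small ?mulr0 ?addr0 //; lia.
- by rewrite !qbinn (qbin_small (ltnSn n)) subnn mulr1 add0r.
Qed.

Lemma qbin_pascal' n j : qbin n.+1 j.+1 = x ^+ j.+1 * qbin n j.+1 + qbin n j.
Proof.
case: (ltngtP j n) => [jn|nj|->].
- have [k nE] : exists k, n = (j + k.+1)%N by exists (n - j.+1)%N; lia.
  have -> : qbin n.+1 j.+1 = qpoch n.+1 / (qpoch j.+1 * qpoch k.+1).
    by rewrite nE -addSn qbin_add.
  have -> : qbin n j.+1 = qpoch n / (qpoch j.+1 * qpoch k).
    by rewrite nE addnS -addSn qbin_add.
  have -> : qbin n j = qpoch n / (qpoch j * qpoch k.+1) by rewrite nE qbin_add.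
  have xE : x ^+ n.+1 = x ^+ j.+1 * x ^+ k.+1 by rewrite -exprD; congr (_ ^+ _); lia.
  rewrite !qpochS xE; have := oneB_neq0 j; have := oneB_neq0 k.
  move: (x ^+ j.+1) (x ^+ k.+1) => a b b1 a1.
  field; rewrite ?qpoch_neq0 ?a1 ?b1 //.
- by rewrite !qbin_small ?mulr0 ?addr0 //; lia.
- by rewrite !qbinn (qbin_small (ltnSn n)) mulr0 add0r.
Qed.

Lemma qbinomial_theorem n t :
  \prod_(i < n) (1 + t * x ^+ i) = \sum_(j < n.+1) x ^+ 'C(j, 2) * qbin n j * t ^+ j.
Proof.
elim: n => [|n IHn]; first by rewrite big_ord0 big_ord1 qbin0 !mulr1.
rewrite big_ord_recr /= IHn [RHS]big_ord_recl /= qbin0.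
under [X in _ = _ + X]eq_bigr => j _.
  have -> : x ^+ 'C(bump 0 j, 2) * qbin n.+1 (bump 0 j) * t ^+ bump 0 j =
     x ^+ 'C(j.+1, 2) * qbin n j.+1 * t ^+ j.+1 +
     x ^+ 'C(j, 2) * qbin n j * t ^+ j * (t * x ^+ n).
    have jn : (j <= n)%N by rewrite -ltnS.
    rewrite /bump leq0n add1n qbin_pascal binS bin1 exprD.
    have -> : x ^+ n = x ^+ (n - j) * x ^+ j by rewrite -exprD subnK.
    by rewrite exprS; ring.
  over.
rewrite big_split /= addrA -[in RHS]mulr_suml mulrDr mulr1; congr (_ + _).
rewrite [LHS]big_ord_recl [X in _ = _ + X]big_ord_recr /= (qbin_small (ltnSn n)) mulr0 mul0r addr0.
by rewrite qbin0.
Qed.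

Lemma alternating_qbin_sum n :
  \sum_(j < n.+1) (-1) ^+ j * x ^+ 'C(j, 2) * qbin n j = (n == 0)%:R.
Proof.
transitivity (\prod_(i < n) (1 + (-1) * x ^+ i)).
  by rewrite qbinomial_theorem; apply: eq_bigr => j _; ring.
by case: n => [|n]; rewrite ?big_ord0 // big_ord_recl expr0 mulr1 subrr mul0r.
Qed.

(** A limiting case of q-Chu-Vandermonde. The induction is on [n] for all [c] at once: Pascal's rule
    splits the sum into those for [(n, c)] and [(n, c + 1)], the latter multiplied by
    [x^(n+1+c)]. *)
Lemma qvandermonde n c :
  \sum_(j < n.+1) x ^+ (j * (j + c)) * qbin n j / qpoch (j + c) = (qpoch (n + c))^-1.
Proof.
elim: n c => [|n IHn] c; first by rewrite big_ord1 qbin0 !mul1r.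
rewrite big_ord_recl /= qbin0.
under eq_bigr => j _.
  have -> : x ^+ (bump 0 j * (bump 0 j + c)) * qbin n.+1 (bump 0 j) / qpoch (bump 0 j + c) =
     x ^+ (j.+1 * (j.+1 + c)) * qbin n j.+1 / qpoch (j.+1 + c) +
     x ^+ (n.+1 + c) * (x ^+ (j * (j + c.+1)) * qbin n j / qpoch (j + c.+1)).
    have jn : (j <= n)%N by rewrite -ltnS.
    rewrite /bump leq0n add1n qbin_pascal addSnnS mulrDr mulrDl; congr (_ + _).
    rewrite !mulrA -!exprD; congr (x ^+ _ * _ * _).
    by rewrite mulSn; lia.
  over.
rewrite big_split /= addrA -mulr_sumr IHn.
rewrite [X in _ + X + _]big_ord_recr /= (qbin_small (ltnSn n)) mulr0 mul0r addr0.
have := IHn c; rewrite big_ord_recl /= qbin0 => ->.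
rewrite addSn addnS qpochS; have := oneB_neq0 (n + c).
by move: (x ^+ _) => a a1; field; rewrite qpoch_neq0 a1.
Qed.

(** The q-falling factorial. For [b > r] it vanishes through the factor [i = r]. *)
Definition qfall r b : R := \prod_(i < b) (1 - x ^+ (r - i)).

Lemma qfallS r b : qfall r b.+1 = qfall r b * (1 - x ^+ (r - b)).
Proof. by rewrite /qfall big_ord_recr. Qed.

Lemma qfall_small r b : (r < b)%N -> qfall r b = 0.
Proof.
move=> rb; rewrite /qfall (bigD1 (Ordinal rb)) //= subnn expr0 subrr mul0r //.
Qed.

Lemma qfallE r b : (b <= r)%N -> qfall r b = qpoch r / qpoch (r - b).
Proof.
elim: b => [|b IHb] br; first by rewrite /qfall big_ord0 subn0 divff ?qpoch_neq0.
rewrite qfallS IHb 1?ltnW //; have -> : (r - b = (r - b.+1).+1)%N by lia.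
rewrite qpochS; have := oneB_neq0 (r - b.+1).
by move: (x ^+ _) => a a1; field; rewrite qpoch_neq0 a1.
Qed.

Lemma qbin_qfall r b : qbin r b = qfall r b / qpoch b.
Proof.
case: (leqP b r) => br; last by rewrite qbin_small // qfall_small // mul0r.
by rewrite /qbin br qfallE // invfM mulrA mulrAC.
Qed.

(** By the second Pascal rule, consecutive terms combine through [qfall r b - qfall r b.+1 = x^(r-b)
    qfall r b], which extracts a factor [x^r] at each step of the induction on [n]. *)
Lemma alternating_qfall_sum n r :
  \sum_(b < n.+1) (-1) ^+ b * x ^+ 'C(b, 2) * qbin n b * qfall r b = x ^+ (n * r).
Proof.
elim: n => [|n IHn].
  by rewrite big_ord1 qbin0 /qfall big_ord0 !mulr1.
rewrite mulSn exprD -IHn big_ord_recl /= qbin0.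
under eq_bigr => b _.
  have -> : (-1) ^+ bump 0 b * x ^+ 'C(bump 0 b, 2) * qbin n.+1 (bump 0 b) * qfall r (bump 0 b) =
     (-1) ^+ b.+1 * x ^+ 'C(b.+2, 2) * qbin n b.+1 * qfall r b.+1 -
     (-1) ^+ b * x ^+ 'C(b.+1, 2) * qbin n b * qfall r b.+1.
    have e1 : 'C(b.+2, 2) = ('C(b.+1, 2) + b.+1)%N by rewrite binS bin1.
    rewrite /bump leq0n add1n qbin_pascal' e1 (exprD x) (exprS (-1)).
    by move: (x ^+ 'C(_, _)) (x ^+ b.+1) => X1 X2; ring.
  over.
rewrite sumrB /= addrA [X in _ + X - _]big_ord_recr /= (qbin_small (ltnSn n)) mulr0 mul0r addr0.
have -> : forall a : R, a = (-1) ^+ 0 * x ^+ 'C(1, 2) * 1 * qfall r 0 -> a +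
  \sum_(i < n) (-1) ^+ i.+1 * x ^+ 'C(i.+2, 2) * qbin n i.+1 * qfall r i.+1 =
  \sum_(i < n.+1) (-1) ^+ i * x ^+ 'C(i.+1, 2) * qbin n i * qfall r i.
  by move=> a ->; rewrite big_ord_recl /= qbin0.
rewrite -sumrB mulr_sumr; apply: eq_bigr => b _.
rewrite qfallS; case: (leqP b r) => br; last by rewrite qfall_small //; ring.
have -> : x ^+ r = x ^+ (r - b) * x ^+ b by rewrite -exprD subnK.
by rewrite binS bin1 exprD; ring.
by [].
Qed.
End QSeries.

Lemma bin2D a b : 'C(a + b, 2) = ('C(a, 2) + 'C(b, 2) + a * b)%N.
Proof.
elim: a => [|a IHa]; first by rewrite mul0n addn0.
by rewrite addSn !binS !bin1 IHa; lia.
Qed.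

Lemma double_bin2 a : ('C(a, 2) + 'C(a, 2) + a = a * a)%N.
Proof. by elim: a => [|a IHa] //; rewrite !binS !bin1; lia. Qed.

(** * Finite Jacobi triple product, Bailey chain and the law of the kernel *)

Section Bailey.
Variables (R : realFieldType) (x : R).
Hypotheses (x_gt0 : 0 < x) (x_lt1 : x < 1).
Local Notation qpoch := (qpoch x).
Local Notation qbin := (qbin x).

Let qpoch_neq0 := qpoch_neq0 x_gt0 x_lt1.
Let x_neq0 : x != 0. Proof. by rewrite gt_eqF. Qed.

(** With [A B = y], the terms of index [r] and [-r] of the theta series of
    [(-1)^r y^(r(r-1)/2) A^r], folded together; the term [0] is counted once. *)
Definition theta_coef (y A B : R) r : R :=
  if r == 0%N then 1 else (-1) ^+ r * y ^+ 'C(r, 2) * (A ^+ r + B ^+ r).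

(** The q-binomial theorem with [2 L] factors at [t = - A / x^L]: the last [L] factors involve [A],
    the first [L] become those of [B], and the terms [L + r] and [L - r] pair up. *)
Lemma finite_jacobi A B L : A * B = x ->
  \prod_(i < L) ((1 - A * x ^+ i) * (1 - B * x ^+ i)) =
  \sum_(r < L.+1) theta_coef x A B r * qbin (L + L) (L - r).
Proof.
move=> AB.
have [A0 B0] : A != 0 /\ B != 0.
  by apply/andP; rewrite -negb_or -mulf_eq0 AB.
(* [K] clears the negative powers: [- B x^i (1 - A x^(-1-i)) = 1 - B x^i] since [A B = x]. *)
pose K := \prod_(i < L) (- B * x ^+ i).
have KE : K = (-1) ^+ L * B ^+ L * x ^+ 'C(L, 2).
  rewrite /K; elim: (L) => [|l IHl]; first by rewrite big_ord0 !mulr1.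
  by rewrite big_ord_recr /= IHl binS bin1 exprD !exprS; ring.
have first_half : K * \prod_(i < L) (1 + (- A / x ^+ L) * x ^+ i) =
    \prod_(i < L) (1 - B * x ^+ i).
  rewrite (reindex_inj rev_ord_inj) /K -big_split /=; apply: eq_bigr => i _.
  have -> : x ^+ L = x ^+ (L - i.+1) * (x ^+ i * x) by rewrite -exprSr -exprD subnK.
  have : x ^+ (L - i.+1) != 0 by rewrite expf_neq0.
  have : x ^+ i != 0 by rewrite expf_neq0.
  move: (x ^+ (L - i.+1)) (x ^+ i) => b a a0 b0; rewrite -AB.
  by field; rewrite A0 B0 a0 b0.
have term_up r : K * (x ^+ 'C(L + r, 2) * (- A / x ^+ L) ^+ (L + r)) =
    (-1) ^+ r * x ^+ 'C(r, 2) * A ^+ r.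
  rewrite KE.
  have xL : x ^+ (L * (L + r)) != 0 by rewrite expf_neq0.
  have e : x ^+ 'C(L, 2) * x ^+ 'C(L + r, 2) * x ^+ L = x ^+ 'C(r, 2) * x ^+ (L * (L + r)).
    by rewrite -!exprD; congr (_ ^+ _); have := bin2D L r; have := double_bin2 L; lia.
  have s : (-1) ^+ L * (- A) ^+ (L + r) * B ^+ L = (-1) ^+ r * A ^+ r * x ^+ L.
    rewrite -AB [(- A) ^+ _]exprNn !exprD exprMn.
    transitivity (((-1) ^+ L) ^+ 2 * ((-1) ^+ r * A ^+ L * B ^+ L * A ^+ r) : R); first by ring.
    by rewrite sqrr_sign; ring.
  rewrite exprMn exprVn -exprM.
  transitivity ((-1) ^+ L * (- A) ^+ (L + r) * B ^+ L *
      (x ^+ 'C(L, 2) * x ^+ 'C(L + r, 2)) / x ^+ (L * (L + r))); first by ring.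
  rewrite s; transitivity ((-1) ^+ r * A ^+ r *
      (x ^+ 'C(L, 2) * x ^+ 'C(L + r, 2) * x ^+ L) / x ^+ (L * (L + r))); first by ring.
  by rewrite e mulrA mulfK //; ring.
have term_down r : (r <= L)%N -> K * (x ^+ 'C(L - r, 2) * (- A / x ^+ L) ^+ (L - r)) =
    (-1) ^+ r * x ^+ 'C(r, 2) * B ^+ r.
  move=> rL; rewrite KE.
  have xL : x ^+ (L * (L - r)) != 0 by rewrite expf_neq0.
  have e : x ^+ 'C(L, 2) * x ^+ 'C(L - r, 2) * x ^+ (L - r) = x ^+ 'C(r, 2) * x ^+ (L * (L - r)).
    rewrite -!exprD; congr (_ ^+ _); have := bin2D (L - r) r; have := double_bin2 (L - r).
    by rewrite subnK //; nia.
  have s : (-1) ^+ L * (- A) ^+ (L - r) * B ^+ L = (-1) ^+ r * B ^+ r * x ^+ (L - r).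
    rewrite -{1 3}(subnK rL) -AB [(- A) ^+ _]exprNn !exprD exprMn.
    transitivity (((-1) ^+ (L - r)) ^+ 2 *
      ((-1) ^+ r * A ^+ (L - r) * B ^+ (L - r) * B ^+ r) : R); first by ring.
    by rewrite sqrr_sign; ring.
  rewrite exprMn exprVn -exprM.
  transitivity ((-1) ^+ L * (- A) ^+ (L - r) * B ^+ L *
      (x ^+ 'C(L, 2) * x ^+ 'C(L - r, 2)) / x ^+ (L * (L - r))); first by ring.
  rewrite s; transitivity ((-1) ^+ r * B ^+ r *
      (x ^+ 'C(L, 2) * x ^+ 'C(L - r, 2) * x ^+ (L - r)) / x ^+ (L * (L - r))); first by ring.
  by rewrite e mulrA mulfK //; ring.
have sym r : (r <= L)%N -> qbin (L + L) (L + r) = qbin (L + L) (L - r).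
  move=> rL; rewrite /qbin leq_add2l rL (leq_trans (leq_subr _ _) (leq_addl _ _)).
  have -> : (L + L - (L + r) = L - r)%N by lia.
  have -> : (L + L - (L - r) = L + r)%N by lia.
  by rewrite [qpoch (L - r) * _]mulrC.
transitivity (K * \prod_(i < L + L) (1 + (- A / x ^+ L) * x ^+ i)).
  rewrite big_split_ord /= mulrA first_half big_split /= mulrC; congr (_ * _).
  apply: eq_bigr => i _; rewrite exprD; field.
  by rewrite expf_neq0.
rewrite qbinomial_theorem // mulr_sumr -addnS big_split_ord /=.
have term_mul (a c d : R) : K * (a * c * d) = K * (a * d) * c by ring.
under eq_bigr do rewrite term_mul.
under [X in _ + X]eq_bigr do rewrite term_mul term_up.
rewrite [X in _ + X]big_ord_recl [RHS]big_ord_recl /= addn0 subn0 addrCA !mulr1 mul1r.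
congr (_ + _).
rewrite (reindex_inj rev_ord_inj) -big_split /=; apply: eq_bigr => i _.
rewrite /bump leq0n add1n /theta_coef /=.
have iL : (i < L)%N by [].
by rewrite term_down // sym //; ring.
Qed.

(** The [beta_N] of the Bailey pair relative to [1] with
    [alpha_r = theta_coef x 1 x r * x^(k r^2)]. *)
Definition bailey k N : R :=
  \sum_(r < N.+1) theta_coef x 1 x r * x ^+ (k * (r * r)) / (qpoch (N - r) * qpoch (N + r)).

(** For [N > 0], this is [finite_jacobi] at [A = 1], where the product has the factor [1 - 1]. *)
Lemma bailey0 N : bailey 0 N = (N == 0%N)%:R.
Proof.
case: N => [|N].
  by rewrite /bailey big_ord1 /= /theta_coef eqxx addn0 /= !qpoch0 !mulr1 divr1.
have := @finite_jacobi 1 x N.+1 (mul1r x).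
rewrite [LHS]big_ord_recl expr0 mulr1 subrr !mul0r.
move=> /esym/(congr1 (fun z => z / qpoch (N.+1 + N.+1))).
rewrite mul0r mulr_suml => e; rewrite -[RHS]e /bailey; apply: eq_bigr => r _.
have rN : (r <= N.+1)%N by rewrite -ltnS.
rewrite mul0n expr0 mulr1 /qbin (leq_trans (leq_subr _ _) (leq_addl _ _)).
have -> : (N.+1 + N.+1 - (N.+1 - r) = N.+1 + r)%N by lia.
by field; rewrite !qpoch_neq0.
Qed.

(* The Bailey lemma for the Bailey pairs relative to 1, with both parameters
   sent to infinity. *)
Lemma bailey_chain k L :
  \sum_(n < L.+1) x ^+ (n * n) * bailey k n / qpoch (L - n) = bailey k.+1 L.
Proof.
pose f (n r : nat) : R := theta_coef x 1 x r * x ^+ (k * (r * r)) *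
  (x ^+ (n * n) / (qpoch (L - n) * qpoch (n - r) * qpoch (n + r))).
transitivity (\sum_(r < L.+1) \sum_(n < L.+1 | (r <= n)%N) f n r).
  rewrite (exchange_big_dep predT) //=; apply: eq_bigr => n _.
  have nL : (n < L.+1)%N by [].
  rewrite /bailey mulr_sumr mulr_suml.
  rewrite (big_ord_widen L.+1 (fun r => x ^+ (n * n) * (theta_coef x 1 x r *
    x ^+ (k * (r * r)) / (qpoch (n - r) * qpoch (n + r))) / qpoch (L - n))) //.
  apply: eq_big => [r|r _]; first by rewrite ltnS.
  by rewrite /f; field; rewrite !qpoch_neq0.
apply: eq_bigr => r _; have rL : (r <= L)%N by rewrite -ltnS.
rewrite -(big_geq_mkord r L.+1 xpredT (f^~ r)) -{1}[nat_of_ord r]add0n big_addn subSn // big_mkord.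
(* After the substitution [n = j + r], the inner sum is a q-Vandermonde sum with [c = 2 r]. *)
have e := qvandermonde x_gt0 x_lt1 (L - r) (r + r).
rewrite mulSn [in RHS]exprD.
transitivity (theta_coef x 1 x r * x ^+ (k * (r * r)) * x ^+ (r * r) / qpoch (L - r) *
    (qpoch (L - r + (r + r)))^-1); last first.
  have -> : (L - r + (r + r) = L + r)%N by lia.
  by rewrite invfM; ring.
rewrite -e mulr_sumr; apply: eq_bigr => j _.
have jL : (j <= L - r)%N by rewrite -ltnS.
rewrite /f /qbin jL addnK.
have -> : (L - (j + r) = L - r - j)%N by lia.
have -> : (j + r + r = j + (r + r))%N by lia.
have -> : ((j + r) * (j + r) = r * r + j * (j + (r + r)))%N by lia.
by rewrite exprD; field; rewrite !qpoch_neq0.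
Qed.

Definition euler_term r : R := (-1) ^+ r * x ^+ 'C(r.+1, 2) / qpoch r.

(** A q-analogue of inclusion-exclusion, with [n %/ m] in the place of [J]. At [N = 0] it is a
    partial sum of Euler's series for [(x)_oo]. *)
Definition kernel_law J N : R :=
  (-1) ^+ N * x ^+ 'C(N, 2) * \sum_(r < J.+1) euler_term r * qbin r N.

(** Summing over [N] first, [alternating_qbin_sum] annihilates every [r > 0]. *)
Lemma sum_kernel_law J : \sum_(N < J.+1) kernel_law J N = 1.
Proof.
rewrite /kernel_law; under eq_bigr => N _ do rewrite mulr_sumr.
rewrite exchange_big /= big_ord_recl /= [X in _ + X]big1 ?addr0 => [|r _].
  rewrite big_ord_recl /= big1 ?addr0 => [|N _].
    rewrite qbin0 // /euler_term qpoch0 (_ : 'C(1, 2) = 0%N) // (_ : 'C(0, 2) = 0%N) //.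
    by rewrite !expr0; field.
  by rewrite qbin_small // !mulr0.
set s := bump 0 r.
transitivity (euler_term s * \sum_(j < s.+1) (-1) ^+ j * x ^+ 'C(j, 2) * qbin s j).
  rewrite mulr_sumr (big_ord_widen J.+1
    (fun j => euler_term s * ((-1) ^+ j * x ^+ 'C(j, 2) * qbin s j))).
    rewrite [RHS]big_mkcond /=; apply: eq_bigr => j _; case: ltnP => [_|sj]; first by ring.
    by rewrite qbin_small // !mulr0.
  by rewrite /s /bump leq0n add1n ltnS.
by rewrite alternating_qbin_sum // mulr0.
Qed.

(** Both sides equal [x^(N^2) / (x)_N] times the sum of [euler_term r * x^(N r)] over [r <= J - N]:
    the left by shifting [r] by [N], the right by [alternating_qfall_sum]. *)
Lemma kernel_law_rec J N : (N <= J)%N ->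
  kernel_law J N = x ^+ (N * N) * \sum_(b < N.+1) kernel_law (J - N) b / qpoch (N - b).
Proof.
move=> NJ; transitivity (x ^+ (N * N) / qpoch N *
    \sum_(r < (J - N).+1) euler_term r * x ^+ (N * r)).
  rewrite /kernel_law -(big_mkord xpredT (fun r => euler_term r * qbin r N)).
  rewrite (@big_cat_nat _ _ _ N) //= 1?ltnW // big_nat_cond big1 ?add0r; last first.
    by move=> r /andP[/andP[_ rN] _]; rewrite qbin_small // mulr0.
  rewrite -[X in \sum_(X <= _ < _) _]add0n big_addn subSn // big_mkord !mulr_sumr.
  apply: eq_bigr => r _.
  rewrite addnC qbin_add // /euler_term.
  have -> : 'C((N + r).+1, 2) = ('C(r.+1, 2) + N * r + ('C(N, 2) + N))%N.
    by rewrite -addnS bin2D; lia.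
  rewrite -(double_bin2 N); move: 'C(r.+1, 2) 'C(N, 2) => c1 c2; rewrite !exprD.
  transitivity ((-1) ^+ N ^+ 2 * ((-1) ^+ r *
    (x ^+ c2 * x ^+ c2 * x ^+ N * x ^+ c1 * x ^+ (N * r)) / (qpoch N * qpoch r))).
    by field; rewrite !qpoch_neq0.
  by rewrite sqrr_sign; field; rewrite !qpoch_neq0.
rewrite -mulrA; congr (_ * _).
transitivity (\sum_(r < (J - N).+1) \sum_(b < N.+1) euler_term r / qpoch N *
    ((-1) ^+ b * x ^+ 'C(b, 2) * qbin N b * qfall x r b)).
  rewrite mulr_sumr; apply: eq_bigr => r _.
  by rewrite -mulr_sumr alternating_qfall_sum //; ring.
rewrite exchange_big /=; apply: eq_bigr => b _.
rewrite /kernel_law mulr_sumr mulr_suml; apply: eq_bigr => r _.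
have bN : (b <= N)%N by rewrite -ltnS.
by rewrite (qbin_qfall _ _ r) // /qbin bN; field; rewrite !qpoch_neq0.
Qed.
End Bailey.

(** * The law of the ranks of [phi(alpha)^i] *)

Section Law.
Variables (R : realFieldType) (F : finFieldType) (phi : {poly F}).
Hypotheses (phi_monic : phi \is monic) (phi_irr : irreducible_poly phi).
Hypothesis phi0_neq0 : phi.[0] != 0.
Local Notation m := (size phi).-1.
Local Notation q := #|F|.
Let phi_gt1 : (1 < size phi)%N. Proof. by case: phi_irr. Qed.
Let m_gt0 : (0 < m)%N. Proof. by rewrite -ltnS (ltn_predK phi_gt1). Qed.
Let q_gt1 : (1 < q)%N. Proof. exact: card_finRing_gt1. Qed.

Definition residue_inv : R := (q%:R ^+ m)^-1.
Local Notation x := residue_inv.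

Lemma residue_inv_gt0 : 0 < x.
Proof. by rewrite invr_gt0 exprn_gt0 // ltr0n ltnW. Qed.

Lemma residue_inv_le_half : x <= 2^-1.
Proof.
have q2 : 2 <= q%:R :> R by rewrite (ler_nat R 2).
rewrite lef_pV2 ?posrE ?exprn_gt0 // ?(lt_le_trans _ q2) //.
by rewrite (le_trans q2) // ler_eXnr // (le_trans _ q2) // ler1n.
Qed.

Lemma residue_inv_lt1 : x < 1.
Proof. by apply: le_lt_trans residue_inv_le_half _; rewrite invf_lt1 ?ltr1n. Qed.

Definition gl_mean n (H : (nat -> nat) -> R) : R :=
  (\sum_(A : 'M[F]_n | A \in unitmx) H (rank_seq phi A)) / (gl_order F n)%:R.

(* [rank_seq phi A 0] is the dimension, so this is the number of parts of the
   partition attached to [phi]. *)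
Definition ker_mult (r : nat -> nat) : nat := ((r 0 - r 1) %/ m)%N.

Lemma gl_order_gt0 n : (0 < gl_order F n)%N.
Proof. by apply/card_gt0P; exists 1%:M; rewrite inE unitmx1. Qed.

Lemma rank_seq0 n (A : 'M[F]_n) : rank_seq phi A 0 = n.
Proof. by rewrite /rank_seq expr0 pmx1 mxrank1. Qed.

Lemma rank_seq1 n (A : 'M[F]_n) : rank_seq phi A 1 = \rank (pmx A phi).
Proof. by rewrite /rank_seq expr1. Qed.

Lemma ker_multE n (A : 'M[F]_n) :
  (n - \rank (pmx A phi) = ker_mult (rank_seq phi A) * m)%N.
Proof.
rewrite /ker_mult rank_seq0 rank_seq1.
by have [b [_ [_ -> _]]] := free_tuple_basis phi_monic phi_irr A; rewrite mulnK.
Qed.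

(** For [b > N] there is no extension: [ker phi(gamma)] would have to embed in a space of dimension
    [N] over [F[z]/(phi)]. *)
Definition ext_weight N b : R := if (b <= N)%N then x ^+ (N * N) / qpoch x (N - b) else 0.

Let x_gt0 := residue_inv_gt0.
Let x_lt1 := residue_inv_lt1.

Let prodE N b : (b <= N)%N ->
  (\prod_(i < b) (q ^ (N * m) - q ^ (i * m)))%:R =
  q%:R ^+ (b * (N * m)) * (qpoch x N / qpoch x (N - b)) :> R.
Proof.
move=> bN; rewrite natr_prod -qfallE // /qfall.
have -> : q%:R ^+ (b * (N * m)) = \prod_(i < b) q%:R ^+ (N * m) :> R.
  by rewrite prodr_const card_ord -exprM mulnC.
rewrite -big_split /=; apply: eq_bigr => i _.
have iN : (i <= N)%N by rewrite ltnW // (leq_trans _ bN).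
rewrite natrB ?leq_exp2l ?leq_mul2r ?iN ?orbT // !natrX mulrBr mulr1; congr (_ - _).
rewrite /residue_inv exprVn -exprM (_ : N * m = m * (N - i) + i * m)%N; last by nia.
rewrite exprD mulrAC divff ?mul1r //.
by rewrite expf_neq0 // pnatr_eq0 -lt0n ltnW.
Qed.

Lemma gl_mean_kernel N w (H : (nat -> nat) -> R) :
  gl_mean (N * m + w) (fun r => (ker_mult r == N)%:R * H (fun i => r i.+1)) =
  gl_mean w (fun r => H r * ext_weight N (ker_mult r)).
Proof.
have := sum_rank_seq_kernel phi_monic phi_irr phi0_neq0 H N w.
set Pr := (\prod_(i < N) _)%N; set n := (N * m + w)%N => e.
have PrE : Pr%:R = q%:R ^+ (N * (N * m)) * qpoch x N :> R.
  by rewrite /Pr prodE // subnn qpoch0 divr1.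
have q0 j : q%:R ^+ j != 0 :> R by rewrite expf_neq0 // pnatr_eq0 -lt0n ltnW.
have gl0 j : (gl_order F j)%:R != 0 :> R by rewrite pnatr_eq0 -lt0n gl_order_gt0.
have qp0 j : qpoch x j != 0 by exact: qpoch_neq0.
have Pr0 : Pr%:R != 0 :> R by rewrite PrE mulf_neq0.
have -> : gl_mean n (fun r => (ker_mult r == N)%:R * H (fun i => r i.+1)) =
   (\sum_(A : 'M[F]_n | (A \in unitmx) && (\rank (pmx A phi) == w))
     H (fun i => rank_seq phi A i.+1)) / (gl_order F n)%:R.
  congr (_ / _); rewrite [RHS]big_mkcondr /=; apply: eq_bigr => A _.
  have rn := rank_leq_row (pmx A phi); have := ker_multE A.
  case: (eqVneq (ker_mult _) N) => [->|kN] E.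
    have -> : \rank (pmx A phi) == w by apply/eqP; rewrite /n in rn E *; lia.
    by rewrite mul1r.
  have -> : (\rank (pmx A phi) == w) = false; last by rewrite mul0r.
  apply/negP => /eqP rw; move: kN; rewrite rw /n addnK in E.
  by move/eqP: E; rewrite eqn_pmul2r // => /eqP ->; rewrite eqxx.
apply: (mulIf (mulf_neq0 Pr0 (mulf_neq0 (q0 (w * (N * m))%N) (gl0 w)))).
rewrite mulrAC -natrX -!natrM [X in X / _ = _]mulr_natr e.
rewrite /gl_mean [LHS]mulr_suml [in RHS]mulr_suml [in RHS]mulr_suml; apply: eq_bigr => G _.
have := card_extensions phi_monic phi_irr
  (pmx_companion_sum phi_monic phi_irr N) (ker_multE G).
set ext := (X in (X * _)%N = _); set b := ker_mult _ => extE.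
have {}extE : ext%:R = (\prod_(i < b) (q ^ (N * m) - q ^ (i * m)))%:R *
    q%:R ^+ (w * (N * m)) / q%:R ^+ (b * (N * m)) :> R.
  by rewrite -natrX -natrM -extE natrM natrX mulfK.
rewrite -[H _ *+ _]mulr_natr -/ext !natrM extE PrE !natrX /ext_weight.
have xE : x ^+ (N * N) = (q%:R ^+ (N * (N * m)))^-1.
  by rewrite /residue_inv exprVn -exprM; congr (_ ^+ _)^-1; lia.
(* For [b > N] the product contains the zero factor [i = N]. *)
case: leqP => bN; last first.
  by rewrite (bigD1 (Ordinal bN)) //= subnn mul0n !(mul0r, mulr0).
rewrite prodE // xE.
move: (gl0 n) (gl0 w) (qp0 N) (qp0 (N - b)%N) (q0 (N * (N * m))%N)
  (q0 (b * (N * m))%N) (q0 (w * (N * m))%N).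
move: (H _) (gl_order F n)%:R (gl_order F w)%:R (qpoch x N) (qpoch x (N - b))
  (q%:R ^+ (N * (N * m))) (q%:R ^+ (b * (N * m))) (q%:R ^+ (w * (N * m))).
move=> h g1 g2 p1 p2 a1 a2 a3 g10 g20 p10 p20 a10 a20 a30.
by field; rewrite g10 g20 p20 a10 a20.
Qed.

Lemma gl_mean_ext n (H1 H2 : (nat -> nat) -> R) :
  (forall A : 'M[F]_n, A \in unitmx -> H1 (rank_seq phi A) = H2 (rank_seq phi A)) ->
  gl_mean n H1 = gl_mean n H2.
Proof. by move=> e; congr (_ / _); apply: eq_bigr. Qed.

Lemma gl_mean1 n : gl_mean n (fun=> 1) = 1.
Proof.
by rewrite /gl_mean sumr_const divff // pnatr_eq0 -lt0n gl_order_gt0.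
Qed.

Lemma gl_mean_sum n I (s : seq I) (H : I -> (nat -> nat) -> R) :
  gl_mean n (fun r => \sum_(i <- s) H i r) = \sum_(i <- s) gl_mean n (H i).
Proof. by rewrite /gl_mean exchange_big mulr_suml. Qed.

Lemma gl_meanZ n c (H : (nat -> nat) -> R) :
  gl_mean n (fun r => c * H r) = c * gl_mean n H.
Proof. by rewrite /gl_mean -mulr_sumr mulrA. Qed.

Lemma gl_mean_le n (H1 H2 : (nat -> nat) -> R) :
  (forall A : 'M[F]_n, H1 (rank_seq phi A) <= H2 (rank_seq phi A)) ->
  gl_mean n H1 <= gl_mean n H2.
Proof.
move=> le12; rewrite ler_pM2r ?invr_gt0 ?ltr0n ?gl_order_gt0 //.
by apply: ler_sum => A _; exact: le12.
Qed.

Definition joint (P : (nat -> nat) -> bool) n N : R :=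
  gl_mean n (fun r => (ker_mult r == N)%:R * (P r)%:R).

Lemma joint_ge0 P n N : 0 <= joint P n N.
Proof.
rewrite /joint /gl_mean; apply: divr_ge0; last exact: ler0n.
by apply: sumr_ge0 => A _; apply: mulr_ge0; exact: ler0n.
Qed.

Lemma ker_mult_le n (A : 'M[F]_n) : (ker_mult (rank_seq phi A) * m <= n)%N.
Proof. by rewrite -ker_multE leq_subr. Qed.

Lemma sum_joint P n : \sum_(N < n.+1) joint P n N = gl_mean n (fun r => (P r)%:R).
Proof.
rewrite /joint -gl_mean_sum; apply: gl_mean_ext => A _.
have kn : (ker_mult (rank_seq phi A) < n.+1)%N.
  by rewrite ltnS (leq_trans _ (ker_mult_le A)) // leq_pmulr.
rewrite (bigD1 (Ordinal kn)) //= eqxx mul1r big1 ?addr0 // => i /eqP ik.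
case: eqP => [e|_]; last by rewrite mul0r.
by case: ik; apply: val_inj.
Qed.

Lemma joint_big P n N : (n < N * m)%N -> joint P n N = 0.
Proof.
move=> nN; rewrite /joint (gl_mean_ext (H2 := fun=> 0 * 1)) ?gl_meanZ ?mul0r // => A _.
case: eqP => [e|_]; last by rewrite mul0r.
by have := ker_mult_le A; rewrite e leqNgt nN.
Qed.

(* Passing to the quotient by [ker phi(alpha)] shifts the sequence of ranks. *)
Lemma joint_shift P N w :
  joint (fun r => P (fun i => r i.+1)) (N * m + w) N =
  x ^+ (N * N) * \sum_(b < N.+1) joint P w b / qpoch x (N - b).
Proof.
rewrite /joint (gl_mean_kernel N w (fun r => (P r)%:R)) mulr_sumr.
transitivity (\sum_(b < N.+1) gl_mean w (fun r =>
   (x ^+ (N * N) / qpoch x (N - b)) * ((ker_mult r == b)%:R * (P r)%:R))); last first.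
  by apply: eq_bigr => b _; rewrite gl_meanZ; ring.
rewrite -gl_mean_sum; apply: gl_mean_ext => A _; rewrite /ext_weight.
set k := ker_mult _; case: leqP => kN.
  have kN' : (k < N.+1)%N by [].
  rewrite (bigD1 (Ordinal kN')) //= eqxx mul1r big1 ?addr0 1?mulrC // => i /eqP ik.
  case: eqP => [e|_]; last by rewrite mul0r mulr0.
  by case: ik; apply: val_inj.
rewrite mulr0 big1 // => b _; case: eqP => [e|_]; last by rewrite mul0r mulr0.
by move: kN; rewrite e ltnNge -ltnS ltn_ord.
Qed.

Lemma joint_true n N : joint xpredT n N = kernel_law x (n %/ m) N.
Proof.
elim/ltn_ind: n N => n IHn N.
have pos K : (0 < K)%N -> joint xpredT n K = kernel_law x (n %/ m) K.
  move=> K_gt0; case: (leqP (K * m) n) => Kn; last first.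
    rewrite joint_big // /kernel_law big1 ?mulr0 // => r _; rewrite qbin_small ?mulr0 //.
    by apply: leq_trans (ltn_ord r) _; rewrite ltn_divLR.
  have shift := joint_shift xpredT K (n - K * m); rewrite (subnKC Kn) in shift.
  rewrite [LHS]shift kernel_law_rec //; last by rewrite leq_divRL.
  have nE : ((n - K * m) %/ m = n %/ m - K)%N.
    by rewrite -[in RHS](subnKC Kn) divnMDl // addKn.
  congr (_ * _); apply: eq_bigr => b _; rewrite IHn ?nE //.
  by rewrite ltn_subrL muln_gt0 K_gt0 m_gt0 (leq_trans _ Kn) // muln_gt0 K_gt0.
case: N => [|N]; last exact: pos.
(* The case [N = 0] is the complement of the others. [kernel_law] vanishes beyond [n %/ m], so both
   total masses can be taken over the range [n + 1]. *)
have s1 : \sum_(K < n.+1) joint xpredT n K = 1 by rewrite sum_joint gl_mean1.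
have s2 : \sum_(K < n.+1) kernel_law x (n %/ m) K = 1.
  rewrite -(sum_kernel_law x_gt0 x_lt1 (n %/ m)).
  rewrite [RHS](big_ord_widen n.+1 (kernel_law x (n %/ m))) ?ltnS ?leq_div //.
  rewrite [RHS]big_mkcond /=; apply: eq_bigr => j _; case: ltnP => // nj.
  rewrite /kernel_law big1 ?mulr0 // => r _; rewrite qbin_small ?mulr0 //.
  exact: leq_trans (ltn_ord r) nj.
move: s1; rewrite -s2 !big_ord_recl /= => /eqP.
rewrite (eq_bigr (fun i : 'I_n => kernel_law x (n %/ m) (bump 0 i))).
  by move/eqP/addIr.
by move=> i _; exact: pos.
Qed.
End Law.

(** * Limits *)

Section Tannery.
Variables (R : realType) (c x : R).
Hypotheses (x_gt0 : 0 < x) (x_lt1 : x < 1).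

Let c_bound (u : nat -> R) : (forall N, `|u N| <= c * x ^+ N) -> 0 <= c.
Proof. by move=> /(_ 0%N); rewrite expr0 mulr1; apply: le_trans. Qed.

Lemma geometric_tail_le (u : nat -> R) (T M : nat) :
  (forall N, `|u N| <= c * x ^+ N) -> (T <= M)%N ->
  `|\sum_(0 <= N < M) u N - \sum_(0 <= N < T) u N| <= c * x ^+ T / (1 - x).
Proof.
move=> ub TM; have c_ge0 := c_bound ub.
have x1 : 0 < 1 - x by rewrite subr_gt0.
suff : \sum_(T <= N < M) `|u N| <= c * (x ^+ T - x ^+ M) / (1 - x).
  rewrite [X in `|X - _|](@big_cat_nat _ _ _ T) //= addrAC subrr add0r => le_s.
  apply: le_trans (ler_norm_sum _ _ _) _; apply: le_trans le_s _.
  rewrite ler_pM2r ?invr_gt0 // ler_wpM2l // gerBl exprn_ge0 //; exact: ltW.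
elim: M TM => [|M IHM].
  by rewrite leqn0 => /eqP ->; rewrite big_geq // subrr mulr0 mul0r.
rewrite leq_eqVlt => /orP[/eqP <-|]; first by rewrite big_geq // subrr mulr0 mul0r.
rewrite ltnS => TM; rewrite big_nat_recr //=.
apply: le_trans (lerD (IHM TM) (ub M)) _.
rewrite le_eqVlt; apply/orP; left; apply/eqP.
by rewrite exprS; field; rewrite gt_eqF.
Qed.

(** Dominated convergence with a geometric majorant, the range of summation growing with [n].
    Convergence of [series g] is concluded too, since [limn] alone does not assert it. *)
Lemma tannery (f : nat -> nat -> R) (g : nat -> R) :
  (forall n N, `|f n N| <= c * x ^+ N) ->
  (forall N, (f n N @[n --> \oo] --> g N)%classic) ->
  (\sum_(0 <= N < n.+1) f n N @[n --> \oo] --> limn (series g))%classic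
  /\ cvgn (series g).
Proof.
move=> fb fg.
have gb N : `|g N| <= c * x ^+ N.
  have -> : `|g N| = limn (fun n => `|f n N|).
    by apply/esym/cvg_lim => //; apply: cvg_norm; exact: fg.
  apply: limr_le; first by apply/cvg_ex; exists `|g N|; apply: cvg_norm; exact: fg.
  by near=> n.
have c_ge0 := c_bound gb.
have x1 : 0 < 1 - x by rewrite subr_gt0.
have cvg_g : cvgn (series g).
  apply: normed_cvg.
  apply: (@series_le_cvg _ (fun n => `|g n|) (geometric c x)).
  - by move=> n; exact: normr_ge0.
  - by move=> n; apply: geometric_ge0 => //; exact: ltW.
  - by move=> n; exact: gb.
  - by apply: is_cvg_geometric_series; rewrite ger0_norm // ltW.
split=> //.
have tail0 : ((c * x ^+ T / (1 - x)) @[T --> \oo] --> (0 : R))%classic.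
  have -> : (fun T => c * x ^+ T / (1 - x)) = geometric (c / (1 - x)) x.
    by apply/funext => T; rewrite /geometric /=; ring.
  by apply: cvg_geometric; rewrite ger0_norm // ltW.
apply/cvgrPdist_le => e e_gt0.
have e3 : 0 < e / 3 by rewrite divr_gt0.
move/cvgrPdist_le/(_ _ e3): (tail0) => [T _ /(_ T (leqnn _)) /=].
rewrite sub0r normrN => hT.
have {}hT : c * x ^+ T / (1 - x) <= e / 3 by apply: le_trans (ler_norm _) hT.
have lim_tail : `|limn (series g) - series g T| <= e / 3.
  have cv : ((`|series g M - series g T|) @[M --> \oo] --> `|limn (series g) - series g T|)%classic.
    by apply: cvg_norm; apply: cvgB; [exact: cvg_g | exact: cvg_cst].
  rewrite -(cvg_lim _ cv) //; apply: limr_le; first by apply/cvg_ex; eexists; exact: cv.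
  near=> M; apply: le_trans hT; apply: geometric_tail_le => //.
  by near: M; exact: nbhs_infty_ge.
have head : ((\sum_(0 <= N < T) f n N) @[n --> \oo] --> series g T)%classic.
  rewrite /series /=; elim: (T) => [|S IHS].
    by under eq_fun do rewrite big_geq //; rewrite big_geq //; exact: cvg_cst.
  under eq_fun do rewrite big_nat_recr //=.
  by rewrite big_nat_recr //=; apply: cvgD.
move/cvgrPdist_le/(_ _ e3): head => head.
near=> n.
have nT : (T <= n.+1)%N by apply: leqW; near: n; exact: nbhs_infty_ge.
have h1 : `|series g T - \sum_(0 <= N < T) f n N| <= e / 3 by near: n.
have h2 := le_trans (geometric_tail_le (fb n) nT) hT.
have -> : limn (series g) - \sum_(0 <= N < n.+1) f n N =
  (limn (series g) - series g T) + (series g T - \sum_(0 <= N < T) f n N)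
  - (\sum_(0 <= N < n.+1) f n N - \sum_(0 <= N < T) f n N) by ring.
apply: le_trans (ler_normB _ _) _.
have := ler_normD (limn (series g) - series g T) (series g T - \sum_(0 <= N < T) f n N).
by move: lim_tail h1 h2; lra.
Unshelve. all: by end_near. Qed.
End Tannery.

(** * Limits of the finite q-series identities *)

Section QLimits.
Variables (R : realType) (x : R).
Hypotheses (x_gt0 : 0 < x) (x_le_half : x <= 2^-1).

Let x_lt1 : x < 1.
Proof. by apply: le_lt_trans x_le_half _; rewrite invf_lt1 ?ltr1n. Qed.
Let x_ge0 : 0 <= x. Proof. exact: ltW. Qed.

(* Strengthened to [1/4 + x^(n+1)] for [n >= 1] so that the induction goes through. *)
Lemma qpoch_ge_quarter n : 4^-1 <= qpoch x n.
Proof.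
suff : 4^-1 + x ^+ n.+2 <= qpoch x n.+1.
  move=> h; apply: (le_trans _ (qpoch_nonincreasing x_gt0 x_lt1 (leqnSn n))).
  by apply: le_trans h; rewrite lerDl exprn_ge0.
elim: n => [|n IHn].
  have xx : x * x <= 2^-1 * x by rewrite ler_wpM2r.
  have key : 4^-1 + x * x <= 1 - x by move: x_le_half; lra.
  by rewrite qpochS qpoch0 mul1r expr1 expr2.
rewrite qpochS; have xn0 : 0 <= x ^+ n.+2 by rewrite exprn_ge0.
have xn : x ^+ n.+2 <= 4^-1.
  apply: (@le_trans _ _ (x ^+ 2)); first by apply: ler_wiXn2l => //; exact: ltW.
  have xx : x * x <= 2^-1 * x by rewrite ler_wpM2r.
  have key : x * x <= 4^-1 by move: x_le_half; lra.
  by rewrite expr2.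
rewrite (exprS _ n.+2); move: IHn xn0 xn x_le_half; move: (x ^+ n.+2) (qpoch x n.+1) => a b.
move=> h1 h2 h3 h4.
have : (4^-1 + a) * (1 - a) <= b * (1 - a) by rewrite ler_wpM2r //; lra.
have : x * a <= 2^-1 * a by rewrite ler_wpM2r.
have : a * a <= 4^-1 * a by rewrite ler_wpM2r.
by lra.
Qed.

Definition qpoch_inf : R := limn (qpoch x).

Lemma qpoch_cvg : (qpoch x n @[n --> \oo] --> qpoch_inf)%classic.
Proof.
apply: nonincreasing_is_cvgn; first by move=> i j; exact: qpoch_nonincreasing.
by exists 4^-1 => _ [n _ <-]; exact: qpoch_ge_quarter.
Qed.

Lemma qpoch_inf_ge : 4^-1 <= qpoch_inf.
Proof.
apply: limr_ge; first exact: qpoch_cvg.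
by apply: nearW => n; exact: qpoch_ge_quarter.
Qed.

Lemma qpoch_inf_neq0 : qpoch_inf != 0.
Proof. by rewrite gt_eqF // (lt_le_trans _ qpoch_inf_ge) // invr_gt0. Qed.

Lemma qpoch_comp_cvg (h : nat -> nat) : (h n @[n --> \oo] --> \oo)%classic ->
  (qpoch x (h n) @[n --> \oo] --> qpoch_inf)%classic.
Proof. by move=> hoo; apply: cvg_comp hoo _; exact: qpoch_cvg. Qed.

Lemma qpoch_inv_le n : (qpoch x n)^-1 <= 4.
Proof.
rewrite -[4]invrK lef_pV2 ?posrE ?invr_gt0 //; first exact: qpoch_ge_quarter.
exact: qpoch_gt0.
Qed.

Lemma qpoch_ratio_cvg (h : nat -> nat) : (h n @[n --> \oo] --> \oo)%classic ->
  (qpoch x n / qpoch x (h n) @[n --> \oo] --> (1 : R))%classic.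
Proof.
move=> hoo; rewrite -(divff qpoch_inf_neq0).
apply: cvgM; first exact: qpoch_cvg.
by apply: cvgV; [exact: qpoch_inf_neq0 | exact: qpoch_comp_cvg].
Qed.

Lemma qbin_cvg j : (qbin x n j @[n --> \oo] --> (qpoch x j)^-1)%classic.
Proof.
have lim : (qpoch x n / qpoch x (n - j) * (qpoch x j)^-1 @[n --> \oo] -->
    1 * (qpoch x j)^-1)%classic.
  apply: cvgM; last exact: cvg_cst.
  by apply: qpoch_ratio_cvg; exact: cvg_subnr.
rewrite mul1r in lim; apply: cvg_trans lim; apply: near_eq_cvg; near=> n.
have jn : (j <= n)%N by near: n; exact: nbhs_infty_ge.
by rewrite /qbin jn invfM; ring.
Unshelve. all: by end_near. Qed.

Lemma qbin_ge0 n j : 0 <= qbin x n j.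
Proof.
rewrite /qbin; case: ifP => // _.
by rewrite divr_ge0 ?mulr_ge0 // ltW // qpoch_gt0.
Qed.

Lemma qbin_le n j : qbin x n j <= 4.
Proof.
rewrite /qbin; case: ifP => // jn.
rewrite invfM mulrCA; apply: (@le_trans _ _ (4 * 1)); last by rewrite mulr1.
have p0 i := ltW (qpoch_gt0 x_gt0 x_lt1 i).
apply: ler_pM; rewrite ?invr_ge0 ?divr_ge0 ?qpoch_inv_le //.
by rewrite ler_pdivrMr ?qpoch_gt0 // mul1r qpoch_nonincreasing // leq_subr.
Qed.

Lemma leq_bin2S r : (r <= 'C(r.+1, 2))%N.
Proof. by rewrite binS bin1 leq_addl. Qed.

Lemma expr_le_expr i j : (i <= j)%N -> x ^+ j <= x ^+ i.
Proof. by move=> ij; apply: ler_wiXn2l => //; exact: ltW. Qed.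

(** The q-binomial theorem expands [(x)_n] at [t = - x], and each term tends to the corresponding
    [euler_term]. *)
Lemma euler_cvg : (series (euler_term x) n @[n --> \oo] --> qpoch_inf)%classic.
Proof.
pose f n j : R := (-1) ^+ j * x ^+ 'C(j.+1, 2) * qbin x n j.
have [|//|lim_f cv] := @tannery R 4 x x_gt0 x_lt1 f (euler_term x).
- move=> n j; rewrite /f !normrM normrX normrN1 expr1n mul1r.
  rewrite ger0_norm ?exprn_ge0 // ger0_norm ?qbin_ge0 // mulrC.
  by apply: ler_pM => //; rewrite ?qbin_ge0 ?exprn_ge0 ?qbin_le ?expr_le_expr ?leq_bin2S.
- move=> j; rewrite /euler_term; apply: cvgM; first exact: cvg_cst.
  exact: qbin_cvg.
suff <- : limn (series (euler_term x)) = qpoch_inf by [].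
apply: (cvg_unique _ lim_f) => //=.
apply: cvg_trans qpoch_cvg; apply: near_eq_cvg; near=> n.
rewrite big_mkord /f.
have -> : qpoch x n = \prod_(i < n) (1 + (- x) * x ^+ i).
  by rewrite /qpoch; apply: eq_bigr => i _; rewrite exprS mulNr.
rewrite qbinomial_theorem //; apply: eq_bigr => j _.
by rewrite binS bin1 exprD [(- x) ^+ _]exprNn; ring.
Unshelve. all: by end_near. Qed.

Definition theta_term k r : R := theta_coef x 1 x r * x ^+ (k * (r * r)).

Lemma theta_term_le k r : (0 < k)%N -> `|theta_term k r| <= 2 * x ^+ r.
Proof.
move=> k_gt0; rewrite /theta_term normrM [X in _ * X]ger0_norm ?exprn_ge0 //.
apply: ler_pM => //; rewrite ?exprn_ge0 //; last by apply: expr_le_expr; nia.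
rewrite /theta_coef; case: ifP => _; first by rewrite normr1 ler1n.
rewrite !normrM normrX normrN1 expr1n mul1r.
rewrite ger0_norm ?exprn_ge0 // ger0_norm ?addr_ge0 ?exprn_ge0 //.
rewrite -[2]mul1r; apply: ler_pM; rewrite ?addr_ge0 ?exprn_ge0 //.
  by rewrite exprn_ile1 // ltW.
have : x ^+ r <= 1 by rewrite exprn_ile1 // ltW.
lra.
Qed.

Lemma bailey_theta_cvg k : (0 < k)%N ->
  (qpoch x L * bailey x k L @[L --> \oo] --> limn (series (theta_term k)) / qpoch_inf)%classic.
Proof.
move=> k_gt0.
pose f L r : R := theta_term k r * (qpoch x L / qpoch x (L - r) / qpoch x (L + r)).
(* [32 = 2 * 16]: the theta term is at most [2 x^r], and the three Pochhammer factors at most [1],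
   [4] and [4]. *)
have [| |lim_f cv] := @tannery R 32 x x_gt0 x_lt1 f (fun r => theta_term k r / qpoch_inf).
- move=> L r; rewrite /f normrM; have := theta_term_le r k_gt0.
  have p0 j := ltW (qpoch_gt0 x_gt0 x_lt1 j).
  have : `|qpoch x L / qpoch x (L - r) / qpoch x (L + r)| <= 16.
    rewrite ger0_norm ?divr_ge0 // (_ : 16 = 1 * 4 * 4); last by rewrite mul1r -natrM.
    by do 2!(apply: ler_pM; rewrite ?divr_ge0 ?invr_ge0 ?qpoch_inv_le //); exact: qpoch_le1.
  move=> h1 h2; apply: le_trans (ler_pM _ _ h2 h1) _ => //.
  by move: (x ^+ r) => a; lra.
- move=> r.
  have -> : theta_term k r / qpoch_inf = theta_term k r * (1 / qpoch_inf) by rewrite div1r.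
  rewrite /f; apply: cvgM; first exact: cvg_cst.
  apply: cvgM; first by apply: qpoch_ratio_cvg; exact: cvg_subnr.
  apply: cvgV; first exact: qpoch_inf_neq0.
  by apply: qpoch_comp_cvg; exact: cvg_addnr.
have th_cvg : cvgn (series (theta_term k)).
  have [||_] := @tannery R 2 x x_gt0 x_lt1 (fun _ r => theta_term k r) (theta_term k) => //.
    by move=> _ r; exact: theta_term_le.
  by move=> r; exact: cvg_cst.
have <- : limn (series (fun r => theta_term k r / qpoch_inf)) =
    limn (series (theta_term k)) / qpoch_inf.
  apply/cvg_lim => //.
  have -> : series (fun r => theta_term k r / qpoch_inf) =
      (fun n => series (theta_term k) n / qpoch_inf).
    by apply/funext => n; rewrite /series /= mulr_suml.
  by apply: cvgM; [exact: th_cvg | exact: cvg_cst].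
apply: cvg_trans lim_f; apply: near_eq_cvg; near=> L.
rewrite big_mkord /bailey mulr_sumr; apply: eq_bigr => r _.
by rewrite /f /theta_term invfM; ring.
Unshelve. all: by end_near. Qed.

(** The limit of [bailey_theta_cvg] for [k.+1], read through one step of the Bailey chain. The
    majorant is a hypothesis because it will come from the bound [joint_le] on probabilities. *)
Lemma bailey_sum_cvg k C :
  (forall N, `|x ^+ (N * N) * bailey x k N| <= C * x ^+ N) ->
  (qpoch x L * bailey x k.+1 L @[L --> \oo] -->
     limn (series (fun N => x ^+ (N * N) * bailey x k N)))%classic.
Proof.
move=> Sb; pose S N : R := x ^+ (N * N) * bailey x k N; rewrite -/S.
pose f L N : R := S N * (qpoch x L / qpoch x (L - N)).
have p0 j := qpoch_gt0 x_gt0 x_lt1 j.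
have [| |lim_f _] := @tannery R C x x_gt0 x_lt1 f S.
- move=> L N; have SN : `|S N| <= C * x ^+ N by exact: Sb.
  rewrite /f normrM; apply: le_trans SN.
  rewrite ler_piMr // ger0_norm ?divr_ge0 ?(ltW (p0 _)) //.
  by rewrite ler_pdivrMr // mul1r qpoch_nonincreasing // leq_subr.
- move=> N; have -> : nbhs (S N) = nbhs (S N * 1) by rewrite mulr1.
  apply: cvgM; first exact: cvg_cst.
  by apply: qpoch_ratio_cvg; exact: cvg_subnr.
apply: cvg_trans lim_f; apply: near_eq_cvg; near=> L.
rewrite big_mkord -bailey_chain // mulr_sumr; apply: eq_bigr => N _.
by rewrite /f /S; ring.
Unshelve. all: by end_near. Qed.
End QLimits.

(** * The infinite product *)

Section Product.
Variables (R : realType) (x : R) (k : nat).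
Hypotheses (x_gt0 : 0 < x) (x_le_half : x <= 2^-1) (k_gt0 : (0 < k)%N).

Let x_ge0 : 0 <= x. Proof. exact: ltW. Qed.
Let x_lt1 : x < 1.
Proof. by apply: le_lt_trans x_le_half _; rewrite invf_lt1 ?ltr1n. Qed.

Local Notation y := (x ^+ (2 * k + 1)).
Let y_gt0 : 0 < y. Proof. exact: exprn_gt0. Qed.
Let y_le_half : y <= 2^-1.
Proof. by apply: le_trans x_le_half; rewrite -{2}[x]expr1; apply: expr_le_expr => //; lia. Qed.
Let y_lt1 : y < 1.
Proof. by apply: le_lt_trans y_le_half _; rewrite invf_lt1 ?ltr1n. Qed.

Definition andrews_gordon_pred (r : nat) : bool :=
  [|| r == 0 %[mod 2 * k + 1], r == k %[mod 2 * k + 1]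
    | r + k == 0 %[mod 2 * k + 1]]%N.

Lemma theta_term_theta_coef r : theta_term x k r = theta_coef y (x ^+ k) (x ^+ k.+1) r.
Proof.
rewrite /theta_term /theta_coef; case: eqP => [->|_].
  by rewrite !muln0 expr0 mulr1.
rewrite expr1n -(double_bin2 r) -!exprM.
have -> : (k * ('C(r, 2) + 'C(r, 2) + r) = 2 * k * 'C(r, 2) + k * r)%N by ring.
have -> : ((2 * k + 1) * 'C(r, 2) = 2 * k * 'C(r, 2) + 'C(r, 2))%N by ring.
have -> : (k.+1 * r = k * r + r)%N by ring.
by move: 'C(r, 2) => c; rewrite !exprD; ring.
Qed.

(** [finite_jacobi] in base [y], multiplied by [(y)_L] so that the coefficients
    [(y)_L * qbin y (2 L) (L - r)] tend to [1]. They are at most [4], which gives the majorant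
    [8 x^r]. *)
Lemma jacobi_cvg :
  (\prod_(i < L) ((1 - y ^+ i.+1) * ((1 - x ^+ k * y ^+ i) * (1 - x ^+ k.+1 * y ^+ i)))
     @[L --> \oo] --> limn (series (theta_term x k)))%classic.
Proof.
pose f L r : R := theta_term x k r *
  (qpoch y L / qpoch y (L - r) * (qpoch y (L + L) / qpoch y (L + r))).
have p0 j := qpoch_gt0 y_gt0 y_lt1 j.
have p0' j := ltW (p0 j).
have [| |lim_f cv] := @tannery R 8 x x_gt0 x_lt1 f (theta_term x k).
- move=> L r; rewrite /f normrM; have := theta_term_le x_gt0 x_le_half r k_gt0.
  have : `|qpoch y L / qpoch y (L - r) * (qpoch y (L + L) / qpoch y (L + r))| <= 4.
    rewrite ger0_norm; last by apply: mulr_ge0; exact: divr_ge0.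
    apply: (@le_trans _ _ (1 * 4)); last by rewrite mul1r.
    apply: ler_pM; rewrite ?divr_ge0 //.
      by rewrite ler_pdivrMr // mul1r qpoch_nonincreasing // leq_subr.
    apply: (@le_trans _ _ (1 * 4)); last by rewrite mul1r.
    apply: ler_pM; rewrite ?invr_ge0 ?qpoch_le1 //.
    exact: qpoch_inv_le.
  move=> h1 h2; apply: le_trans (ler_pM _ _ h2 h1) _ => //.
  by move: (x ^+ r) => a; lra.
- move=> r; have -> : nbhs (theta_term x k r) = nbhs (theta_term x k r * (1 * 1)) by rewrite !mulr1.
  rewrite /f; apply: cvgM; first exact: cvg_cst.
  apply: cvgM; first by apply: qpoch_ratio_cvg => //; exact: cvg_subnr.
  have -> : nbhs (1 : R) = nbhs (qpoch_inf y / qpoch_inf y).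
    by rewrite divff // qpoch_inf_neq0.
  apply: cvgM.
    apply: qpoch_comp_cvg => //; have -> : (fun n => (n + n)%N) = (fun n => (n * 2)%N).
      by apply/funext => n; rewrite muln2 addnn.
    exact: cvg_mulnr.
  apply: cvgV; first exact: qpoch_inf_neq0.
  by apply: qpoch_comp_cvg => //; exact: cvg_addnr.
apply: cvg_trans lim_f; apply: near_eq_cvg; near=> L.
rewrite big_split /= finite_jacobi //; last by rewrite -exprD; congr (_ ^+ _); lia.
rewrite big_mkord -/(qpoch y L) mulr_sumr; apply: eq_bigr => r _.
have rL : (r <= L)%N by rewrite -ltnS.
rewrite -theta_term_theta_coef /f /qbin (leq_trans (leq_subr _ _) (leq_addl _ _)).
have -> : (L + L - (L - r) = L + r)%N by lia.
by rewrite invfM [RHS]mulrCA; congr (_ * _); rewrite [RHS]mulrA [RHS]mulrACA.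
Unshelve. all: by end_near. Qed.

(** Blocks run over [1, ..., 2 k + 1] and not over the residues [0, ..., 2 k], because the product
    starts at [r = 1]. *)
Lemma andrews_gordon_pred_block L s : (0 < s <= 2 * k + 1)%N ->
  andrews_gordon_pred (s + (2 * k + 1) * L) = [|| s == k, s == k.+1 | s == 2 * k + 1]%N.
Proof.
move=> /andP[s0 sk]; rewrite /andrews_gordon_pred; set d := (2 * k + 1)%N.
have modd a : ((a + d * L) %% d = a %% d)%N by rewrite addnC mulnC modnMDl.
rewrite addnAC !modd mod0n (modn_small (m := k)); last by rewrite /d; lia.
have [sd|sd|sd] := ltngtP s d; last 2 first.
- by move: sk; rewrite -/d leqNgt sd.
- by rewrite sd modnn eqxx !orbT.
rewrite (modn_small sd) orbF (gtn_eqF s0) /=; congr (_ || _).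
have [skd|skd] := ltnP (s + k) d; first by rewrite (modn_small skd); rewrite /d in skd *; lia.
have -> : (s + k = 1 * d + (s + k - d))%N by lia.
by rewrite modnMDl modn_small /d; rewrite /d in sd skd *; lia.
Qed.

Lemma partial_product L :
  \prod_(1 <= r < ((2 * k + 1) * L).+1 | andrews_gordon_pred r) (1 - x ^+ r) =
  \prod_(i < L) ((1 - y ^+ i.+1) * ((1 - x ^+ k * y ^+ i) * (1 - x ^+ k.+1 * y ^+ i))).
Proof.
elim: L => [|L IHL]; first by rewrite muln0 big_ord0 big_geq.
rewrite (@big_cat_nat _ _ _ ((2 * k + 1) * L).+1) //=; last by rewrite ltnS leq_mul2l leqnSn orbT.
rewrite IHL big_ord_recr /=; congr (_ * _).
rewrite -add1n big_addn.
have -> : (((2 * k + 1) * L.+1).+1 - (2 * k + 1) * L = (2 * k + 1).+1)%N by lia.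
rewrite big_nat_cond.
rewrite (eq_bigl (fun s => (0 < s < (2 * k + 1).+1) &&
  [|| s == k, s == k.+1 | s == 2 * k + 1])%N); last first.
  by move=> s; apply: andb_id2l => sk; rewrite andrews_gordon_pred_block.
rewrite -(big_nat_cond _ _ 1 (2 * k + 1).+1 (fun s => [|| s == k, s == k.+1 | s == 2 * k + 1]%N)).
rewrite -big_filter (_ : [seq s <- _ | _] = [:: k; k.+1; 2 * k + 1])%N; last first.
  apply: (irr_sorted_eq ltn_trans ltnn).
  - by apply: sorted_filter; [exact: ltn_trans | exact: iota_ltn_sorted].
  - by rewrite /= ltnSn andbT /=; lia.
  - by move=> s; rewrite mem_filter mem_index_iota !inE; lia.
rewrite !big_cons big_nil mulr1 -!exprM -!exprD.
have -> : (2 * k + 1 + (2 * k + 1) * L = (2 * k + 1) * L.+1)%N by lia.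
by ring.
Qed.

(** Monotonicity makes the partial products converge, so their limit may be taken along the
    multiples of [2 k + 1], where [partial_product] applies. *)
Lemma infinite_product_theta :
  infinite_product andrews_gordon_pred (fun r => 1 - x ^+ r) = limn (series (theta_term x k)).
Proof.
rewrite /infinite_product; set t := (fun N => _).
have t_cvg : cvgn t.
  apply: nonincreasing_is_cvgn; last first.
    exists 0 => _ [N _ <-]; apply: prodr_ge0 => r _.
    by rewrite subr_ge0 exprn_ile1 // ltW.
  apply/nonincreasing_seqP => N; rewrite /t big_mkcond [leRHS]big_mkcond /= big_nat_recr //=.
  rewrite ler_piMr //.
    apply: prodr_ge0 => r _; case: ifP => // _.
    by rewrite subr_ge0 exprn_ile1 // ltW.
  by case: ifP => // _; rewrite gerBl exprn_ge0.
have sub : (t ((2 * k + 1) * L)%N @[L --> \oo] --> limn t)%classic.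
  have oo : (((2 * k + 1) * L)%N @[L --> \oo] --> \oo)%classic.
    by apply: cvg_mulnl; rewrite addn1.
  by apply: cvg_comp oo _; exact: t_cvg.
apply: (cvg_unique _ sub) => //=; apply: cvg_trans jacobi_cvg.
by apply: near_eq_cvg; near=> L; rewrite /t partial_product.
Unshelve. all: by end_near. Qed.
End Product.

(** * The limit law *)

Section LawLimit.
Variables (R : realType) (F : finFieldType) (phi : {poly F}).
Hypotheses (phi_monic : phi \is monic) (phi_irr : irreducible_poly phi).
Hypothesis phi0_neq0 : phi.[0] != 0.
Local Notation m := (size phi).-1.
Local Notation x := (residue_inv R phi).

Let m_gt0 : (0 < m)%N.
Proof. by have [phi_gt1 _] := phi_irr; rewrite -ltnS (ltn_predK phi_gt1). Qed.
Let x_gt0 : 0 < x. Proof. exact: residue_inv_gt0. Qed.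
Let x_le_half : x <= 2^-1. Proof. exact: residue_inv_le_half. Qed.
Let x_lt1 : x < 1. Proof. exact: residue_inv_lt1. Qed.

Definition stable_rank K (r : nat -> nat) : bool := r K == r K.+1.

Lemma joint_le_true P n N : joint R phi P n N <= joint R phi xpredT n N.
Proof.
apply: gl_mean_le => A; rewrite ler_wpM2l ?ler0n // ler_nat.
by case: (P _).
Qed.

Lemma sum_joint_le1 n M : \sum_(N < M) joint R phi xpredT n N <= 1.
Proof.
rewrite /joint -gl_mean_sum -[leRHS](gl_mean1 R phi n); apply: gl_mean_le => A.
under eq_bigr do rewrite mulr1.
case: (ltnP (ker_mult phi (rank_seq phi A)) M) => kM.
  rewrite (bigD1 (Ordinal kM)) //= eqxx big1 ?addr0 // => i /eqP ik.
  by case: eqP => // e; case: ik; apply: val_inj.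
rewrite big1 // => i _; case: eqP => // e.
by move: kM; rewrite e leqNgt ltn_ord.
Qed.

(** One use of the recursion: the weights [1 / (x)_(N-b)] are at most [4], the probabilities add up
    to at most [1], and [x^(N^2) <= x^N]. The bound is uniform in [n], as [tannery] requires. *)
Lemma joint_le P n N : joint R phi P n N <= 4 * x ^+ N.
Proof.
apply: le_trans (joint_le_true P n N) _.
have [Nn|Nn] := leqP (N * m) n; last first.
  by rewrite joint_big // mulr_ge0 // exprn_ge0 // ltW.
have shift := joint_shift R phi_monic phi_irr phi0_neq0 xpredT N (n - N * m).
rewrite (subnKC Nn) in shift; rewrite [leLHS]shift mulrC.
apply: ler_pM.
- by apply: sumr_ge0 => b _; rewrite divr_ge0 ?joint_ge0 // ltW // qpoch_gt0.
- by rewrite exprn_ge0 // ltW.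
- apply: (@le_trans _ _ (\sum_(b < N.+1) joint R phi xpredT (n - N * m) b * 4)).
    by apply: ler_sum => b _; rewrite ler_wpM2l ?joint_ge0 // qpoch_inv_le.
  by rewrite -mulr_suml ler_piMl // sum_joint_le1.
- by apply: expr_le_expr => //; case: (N) => // j; rewrite leq_pmulr.
Qed.

(** The recursion has finitely many terms, so limits pass through it; its limiting form is
    [bailey_chain] at [L = N]. *)
Lemma joint_stable_cvg K N :
  (joint R phi (stable_rank K) n N @[n --> \oo] -->
     qpoch_inf x * (x ^+ (N * N) * bailey x K N))%classic.
Proof.
elim: K N => [|K IHK] N.
  have jE n : joint R phi (stable_rank 0) n N = (N == 0)%:R * series (euler_term x) (n %/ m).+1.
    (* [stable_rank 0] says that [phi(alpha)] is invertible, that is, that the kernel multiplicity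
       is [0]. *)
    transitivity ((N == 0)%:R * joint R phi xpredT n 0).
      rewrite /joint -gl_meanZ; apply: gl_mean_ext => A _; rewrite /stable_rank.
      have := ker_multE phi_monic phi_irr A; rewrite -rank_seq1.
      have := rank_leq_row (pmx A phi); rewrite -rank_seq1 -[X in (_ <= X)%N](rank_seq0 phi A).
      rewrite -[X in (X - _)%N](rank_seq0 phi A); set k := ker_mult _ _ => le_r kE.
      have -> : (rank_seq phi A 0 == rank_seq phi A 1) = (k == 0).
        rewrite eqn_leq le_r andbT -subn_eq0 kE muln_eq0.
        by rewrite [(m == 0)]gtn_eqF // orbF.
      rewrite mulr1 -!natrM !mulnb; congr (_ %:R); case: N => [|N].
        by rewrite andbb.
      by case: eqP => // ->.
    rewrite joint_true // /kernel_law bin0n /= !mul1r /series /= big_mkord.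
    by congr (_ * _); apply: eq_bigr => r _; rewrite qbin0 // mulr1.
  rewrite (_ : (fun n => _) =
    (fun n => (N == 0)%:R * series (euler_term x) (n %/ m).+1)); last exact/funext.
  rewrite bailey0 //.
  have -> : qpoch_inf x * (x ^+ (N * N) * (N == 0)%:R) = (N == 0)%:R * qpoch_inf x.
    by case: (N) => [|M]; rewrite /= ?mulr0 ?mul0r // expr0 !mulr1 mul1r.
  apply: cvgM; first exact: cvg_cst.
  have lim1 : (series (euler_term x) J.+1 @[J --> \oo] --> qpoch_inf x)%classic.
    by have := euler_cvg x_gt0 x_le_half; rewrite -(cvg_shiftS (series _)).
  exact: (@cvg_comp _ _ _ (fun n => n %/ m)%N
    (fun J => series (euler_term x) J.+1) _ _ _ (cvg_divnr _ m_gt0) lim1).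
have lim : (x ^+ (N * N) * (\sum_(b < N.+1)
      joint R phi (stable_rank K) (n - N * m) b / qpoch x (N - b))
    @[n --> \oo] --> x ^+ (N * N) *
     (\sum_(b < N.+1) qpoch_inf x * (x ^+ (b * b) * bailey x K b) / qpoch x (N - b)))%classic.
  apply: cvgM; first exact: cvg_cst.
  apply: cvg_big => [|b _]; first exact: add_continuous.
  apply: cvgM; last exact: cvg_cst.
  exact: (@cvg_comp _ _ _ (fun n => n - N * m)%N
    (fun w => joint R phi (stable_rank K) w b) _ _ _ (cvg_subnr (N * m)) (IHK b)).
have -> : qpoch_inf x * (x ^+ (N * N) * bailey x K.+1 N) = x ^+ (N * N) *
     (\sum_(b < N.+1) qpoch_inf x * (x ^+ (b * b) * bailey x K b) / qpoch x (N - b)).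
  rewrite -bailey_chain // mulrCA; congr (_ * _); rewrite mulr_sumr.
  by apply: eq_bigr => b _; rewrite !mulrA.
apply: cvg_trans lim; apply: near_eq_cvg; near=> n.
have Nn : (N * m <= n)%N by near: n; exact: nbhs_infty_ge.
have shift := joint_shift R phi_monic phi_irr phi0_neq0 (stable_rank K) N (n - N * m).
by rewrite (subnKC Nn) in shift; exact: (esym shift).
Unshelve. all: by end_near. Qed.

Lemma stable_rank_cvg k : (0 < k)%N ->
  (gl_mean phi n (fun r => (stable_rank k.-1 r)%:R) @[n --> \oo] -->
     limn (series (theta_term x k)))%classic.
Proof.
case: k => // K _ /=.
have qi0 : 0 < qpoch_inf x.
  by apply: lt_le_trans (qpoch_inf_ge x_gt0 x_le_half); rewrite invr_gt0.
pose S N := x ^+ (N * N) * bailey x K N.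
have [| |lim_f cv] := @tannery R 4 x x_gt0 x_lt1 (joint R phi (stable_rank K))
  (fun N => qpoch_inf x * S N).
- by move=> n N; rewrite ger0_norm ?joint_ge0 // joint_le.
- by move=> N; exact: joint_stable_cvg.
(* The majorant passes from the probabilities to their limits; [16] is [4] divided by the lower
   bound [1/4] of [(x)_oo]. *)
have Sb N : `|S N| <= 16 * x ^+ N.
  have : `|qpoch_inf x * S N| <= 4 * x ^+ N.
    have cvN : (`|joint R phi (stable_rank K) n N| @[n --> \oo] --> `|qpoch_inf x * S N|)%classic.
      by apply: cvg_norm; exact: joint_stable_cvg.
    rewrite -(cvg_lim _ cvN) //; apply: limr_le; first by apply/cvg_ex; eexists; exact: cvN.
    by near=> n; rewrite ger0_norm ?joint_ge0 // joint_le.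
  rewrite normrM gtr0_norm // => h.
  have := ler_wpM2r (normr_ge0 (S N)) (qpoch_inf_ge x_gt0 x_le_half).
  by move: h; move: (`|S N|) (x ^+ N) (qpoch_inf x) => a b c; lra.
have S_cvg : cvgn (series S).
  have [||_] := @tannery R 16 x x_gt0 x_lt1 (fun _ N => S N) S => //.
  by move=> N; exact: cvg_cst.
(* Both sides are limits of [(x)_L * bailey (K + 1) L]. *)
have limS : limn (series S) = limn (series (theta_term x K.+1)) / qpoch_inf x.
  apply: (cvg_unique _ (bailey_sum_cvg x_gt0 x_le_half Sb)) => //=.
  exact: bailey_theta_cvg.
have <- : limn (series (fun N => qpoch_inf x * S N)) = limn (series (theta_term x K.+1)).
  rewrite -[RHS](mulfVK (lt0r_neq0 qi0)) -limS mulrC; apply/cvg_lim => //.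
  have -> : series (fun N => qpoch_inf x * S N) = (fun n => qpoch_inf x * series S n).
    by apply/funext => n; rewrite /series /= mulr_sumr.
  by apply: cvgM; [exact: cvg_cst | exact: S_cvg].
apply: cvg_trans lim_f; apply: near_eq_cvg; near=> n.
by rewrite big_mkord sum_joint.
Unshelve. all: by end_near. Qed.
End LawLimit.

(** * Existence of the cyclic decomposition *)

Section Factors.
Variable F : fieldType.
Implicit Types p phi rho : {poly F}.

Lemma ltn_size_mul p (r : {poly F}) : (1 < size p)%N -> r != 0 -> (size r < size (p * r)%R)%N.
Proof.
move=> p_gt1 r_neq0; have p_neq0 : p != 0 by rewrite -size_poly_gt0 ltnW.
rewrite size_mul // -(prednK (ltnW p_gt1)) addSn /=.
by rewrite -[X in (X < _)%N]add0n ltn_add2r -ltnS prednK // ltnW.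
Qed.

Lemma size_exp_gt1 p a : (1 < size p)%N -> (0 < a)%N -> (1 < size (p ^+ a)%R)%N.
Proof.
move=> p_gt1 a_gt0; have : (0 < (size (p ^+ a)%R).-1)%N.
  by rewrite size_exp muln_gt0 a_gt0 andbT -ltnS prednK // ltnW.
by case: (size _) => [|[|]].
Qed.

Lemma irreducible_factor p : (1 < size p)%N ->
  exists phi, [/\ phi \is monic, irreducible_poly phi & phi %| p].
Proof.
have [d] := ubnP (size p); elim: d p => // d IHd p /ltnSE p_le p_gt1.
have p_neq0 : p != 0 by rewrite -size_poly_gt0 ltnW.
have [irr|/existsNP[r /not_implyP[r_neq1 /not_implyP[r_dvd /negP r_neqp]]]] :=
    pselect (forall r : {poly F}, size r != 1%N -> r %| p -> r %= p).
  exists ((lead_coef p)^-1 *: p); have lc_neq0 : lead_coef p != 0 by rewrite lead_coef_eq0.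
  split; first by rewrite monicE lead_coefZ mulVf.
    split=> [|r r1]; first by rewrite size_scale ?invr_eq0.
    rewrite dvdpZr ?invr_eq0 // => /(irr _ r1) rp.
    by rewrite (eqp_trans rp) // eqp_sym eqp_scale // invr_eq0.
  by rewrite dvdpZl ?invr_eq0.
have r_neq0 : r != 0 by apply: contraTneq r_dvd => ->; rewrite dvd0p.
have r_gt1 : (1 < size r)%N by rewrite ltn_neqAle eq_sym r_neq1 size_poly_gt0.
have r_lt : (size r < size p)%N.
  by rewrite ltn_neqAle dvdp_leq // andbT dvdp_size_eqp.
have [phi [phi_monic phi_irr phi_dvd]] := IHd r (leq_trans r_lt p_le) r_gt1.
by exists phi; split=> //; exact: dvdp_trans r_dvd.
Qed.

Lemma irreducible_multiplicity phi p : (1 < size phi)%N -> p != 0 ->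
  exists a rho, p = phi ^+ a * rho /\ ~~ (phi %| rho).
Proof.
move=> phi_gt1; have [d] := ubnP (size p); elim: d p => // d IHd p /ltnSE p_le p_neq0.
have [/dvdpP[r pE]|ndvd] := boolP (phi %| p); last first.
  by exists 0%N, p; rewrite expr0 mul1r.
have r_neq0 : r != 0 by apply: contraNneq p_neq0 => r0; rewrite pE r0 mul0r.
have r_lt : (size r < size p)%N.
  by rewrite pE mulrC ltn_size_mul.
have [a [rho [rE ndvd]]] := IHd r (leq_trans r_lt p_le) r_neq0.
by exists a.+1, rho; split=> //; rewrite pE rE exprSr mulrAC.
Qed.
End Factors.

Section Split.
Variables (F : fieldType) (n : nat) (alpha : 'M[F]_n).

(** [W] is the direct sum of [W'] and the cyclic space of [v], expressed by elements.
    [summand_indep] gives at once that the sum is direct and, with [summand_kill], that [v] has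
    order [phi^a]. *)
Record is_cyclic_summand (W W' : 'M[F]_n) (v : 'rV[F]_n) (phi : {poly F}) (a : nat) : Prop :=
  CyclicSummand {
    summand_prime : [/\ phi \is monic, irreducible_poly phi & (0 < a)%N];
    summand_mem : (v <= W)%MS;
    summand_kill : v *m pmx alpha (phi ^+ a) = 0;
    summand_indep : forall p, (v *m pmx alpha p <= W')%MS -> phi ^+ a %| p;
    summand_span : forall w : 'rV_n, (w <= W)%MS -> exists p, (w - v *m pmx alpha p <= W')%MS;
    summand_stable : (W' *m alpha <= W')%MS;
    summand_sub : (W' <= W)%MS;
    summand_rank : (\rank W' < \rank W)%N }.

Lemma stable_pmx (W : 'M[F]_n) p : (W *m alpha <= W)%MS -> (W *m pmx alpha p <= W)%MS.
Proof.
move=> Wa; elim/poly_ind: p => [|p c IHp]; first by rewrite pmx0 mulmx0 sub0mx.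
rewrite pmxMXaddC mulmxDr addmx_sub //; last by rewrite mul_mx_scalar scalemx_sub.
by rewrite mulmxA (submx_trans (submxMr _ IHp)).
Qed.

Lemma annihilator_ex : exists2 p, p != 0 & pmx alpha p = 0.
Proof.
exists (char_poly alpha); first by rewrite monic_neq0 // char_poly_monic.
by case: n alpha => [|k] A; [rewrite !thinmx0 | exact: Cayley_Hamilton].
Qed.

Lemma minimal_annihilator (W : 'M[F]_n) : exists p, [/\ p != 0, W *m pmx alpha p = 0 &
  forall r, r != 0 -> W *m pmx alpha r = 0 -> (size p <= size r)%N].
Proof.
have exP : exists d, `[< exists p, [/\ p != 0, W *m pmx alpha p = 0 & size p = d] >].
  have [p p_neq0 p0] := annihilator_ex; exists (size p); apply/asboolP; exists p.
  by rewrite p0 mulmx0.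
case: (ex_minnP exP) => d /asboolP[p [p_neq0 Wp p_size]] min_d.
exists p; split=> // r r_neq0 Wr; rewrite p_size; apply: min_d.
by apply/asboolP; exists r.
Qed.

(* The functional [l] picks the top coordinate of the cyclic space of [v], and
   [W'] is the set of the [w] in [W] with [l (w rho(alpha) p(alpha)) = 0] for
   every [p], where [phi^a rho] is the minimal polynomial on [W]. *)
Lemma cyclic_summand_ex (W : 'M[F]_n) : W != 0 -> (W *m alpha <= W)%MS ->
  exists W' v phi a, is_cyclic_summand W W' v phi a.
Proof.
move=> W_neq0 Wa; have [p [p_neq0 Wp p_min]] := minimal_annihilator W.
have p_gt1 : (1 < size p)%N.
  rewrite ltnNge; apply/negP => /size1_polyC pE; move: p_neq0 Wp.
  rewrite pE pmxC polyC_eq0 mul_mx_scalar => c_neq0 /eqP.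
  by rewrite scalemx_eq0 (negbTE c_neq0) (negbTE W_neq0).
have [phi [phi_monic phi_irr phi_dvd]] := irreducible_factor p_gt1.
have [phi_gt1 _] := phi_irr; have phi_neq0 := monic_neq0 phi_monic.
have [a [rho [pE ndvd]]] := irreducible_multiplicity phi_gt1 p_neq0.
have a_gt0 : (0 < a)%N.
  by rewrite lt0n; apply: contraNneq ndvd => a0; rewrite pE a0 expr0 mul1r in phi_dvd.
set pp := phi ^+ a in pE.
have pp_monic : pp \is monic by rewrite monic_exp.
have pp_neq0 := monic_neq0 pp_monic.
have rho_neq0 : rho != 0 by apply: contraNneq p_neq0 => r0; rewrite pE r0 mulr0.
have cop sigma : ~~ (phi %| sigma) -> coprimep pp sigma.
  by move=> nd; rewrite coprimep_expl // irreducible_poly_coprime.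
(* By minimality of [p], [phi^(a-1) rho] does not kill [W]; applying [rho(alpha)] to a witness [v0]
   gives a vector of order exactly [phi^a]. *)
have [v0 [v0W v0_neq0]] : exists v0 : 'rV_n,
    (v0 <= W)%MS /\ v0 *m pmx alpha (phi ^+ a.-1 * rho) != 0.
  have : W *m pmx alpha (phi ^+ a.-1 * rho) != 0.
    apply/eqP => W0; have := p_min (phi ^+ a.-1 * rho).
    rewrite mulf_neq0 ?expf_neq0 // => /(_ isT W0); apply/negP; rewrite -ltnNge.
    by rewrite pE /pp -{2}(prednK a_gt0) exprS -mulrA ltn_size_mul ?mulf_neq0 ?expf_neq0.
  move=> /rowV0Pn[w0 w0W w0_neq0]; case/submxP: w0W => D w0E.
  by exists (D *m W); rewrite submxMl -mulmxA -w0E.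
pose v := v0 *m pmx alpha rho.
have v_top : v *m pmx alpha (phi ^+ a.-1) != 0 by rewrite /v -mulmxA -pmxM mulrC.
have v_pp : v *m pmx alpha pp = 0.
  rewrite /v -mulmxA -pmxM mulrC -pE; have /submxP[D ->] := v0W.
  by rewrite -mulmxA Wp mulmx0.
have v_ord r : v *m pmx alpha r = 0 -> pp %| r.
  move=> vr; have [->|r_neq0] := eqVneq r 0; first exact: dvdp0.
  have [j [sigma [rE nds]]] := irreducible_multiplicity phi_gt1 r_neq0.
  have [aj|ja] := leqP a j; first by rewrite rE dvdp_mulr // dvdp_exp2l.
  case/negP: v_top; have /Bezout_eq1_coprimepP[[u w] /= uw] := cop _ nds.
  (* If [r] carried only [phi^j] with [j < a], then [phi^(a-1)] would be a combination of [r] and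
     [phi^a] and would kill [v]. *)
  have e : phi ^+ a.-1 = phi ^+ (a.-1 - j) * (w * r + pp * (u * phi ^+ j)).
    rewrite rE [X in _ * X](_ : _ = (u * pp + w * sigma) * phi ^+ j); last by ring.
    by rewrite uw mul1r -exprD subnK // -ltnS prednK.
  rewrite e mulrC pmxM mulmxA pmxD mulmxDr [w * r]mulrC !pmxM !mulmxA vr v_pp.
  by rewrite !mul0mx addr0 mul0mx.
pose d := (size pp).-1.
have pp_gt1 : (1 < size pp)%N by exact: size_exp_gt1.
have d_gt0 : (0 < d)%N by rewrite -ltnS /d prednK // ltnW.
have small r : (size (r %% pp)%R <= d)%N by rewrite -ltnS /d prednK ?ltn_modp ?size_poly_gt0.
pose B : 'M[F]_(d, n) := lin1_mx (fun x : 'rV_d => v *m pmx alpha (rVpoly x)).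
have BE x : x *m B = v *m pmx alpha (rVpoly x).
  have lin : linear (fun x : 'rV[F]_d => v *m pmx alpha (rVpoly x)).
    by move=> c y z; rewrite linearP /= pmxD pmxZ mulmxDr -scalemxAr.
  pose fL := GRing.isLinear.Build F _ _ _ _ lin.
  pose f' : {linear 'rV[F]_d -> 'rV[F]_n} :=
    HB.pack (fun x : 'rV[F]_d => v *m pmx alpha (rVpoly x)) fL.
  exact: (mul_rV_lin1 f').
have B_free : row_free B.
  rewrite -kermx_eq0; apply/eqP/row_matrixP => i; rewrite row0.
  have : row i (kermx B) *m B = 0 by rewrite -row_mul mulmx_ker row0.
  move: (row i _) => y; rewrite BE => /v_ord pp_dvd; apply: (can_inj rVpolyK); rewrite linear0.
  apply/eqP; apply: contraLR pp_dvd => y_neq0; apply/negP => /(dvdp_leq y_neq0).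
  rewrite leqNgt => /negP[]; rewrite -(prednK (ltnW pp_gt1)) ltnS; exact: size_poly.
have last_lt : (d.-1 < d)%N by rewrite ltn_predL.
pose l : 'cV[F]_n := pinvmx B *m delta_mx (Ordinal last_lt) 0.
have lE (r : {poly F}) : (size r <= d)%N -> v *m pmx alpha r *m l = (r`_d.-1)%:M.
  move=> rd; rewrite -{1}(poly_rV_K rd) -BE /l mulmxA mulmxKp // -colE.
  by apply/matrixP => i j; rewrite !ord1 !mxE eqxx mulr1n.
(* Testing [z^j] for [j < d] suffices: for [w] in [W], [w rho(alpha)] is killed by [phi^a], of
   degree [d]. *)
pose M : 'M[F]_(n, d) := \matrix_(i, j) (pmx alpha (rho * 'X^j) *m l) i 0.
have ME (w : 'rV[F]_n) j : (w *m M) 0 j = (w *m (pmx alpha (rho * 'X^j) *m l)) 0 0.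
  by rewrite mxE [RHS]mxE; apply: eq_bigr => c _; rewrite [M _ _]mxE.
pose W' := (W :&: kermx M)%MS.
have W'P (w : 'rV[F]_n) : reflect
    ((w <= W)%MS /\ forall r, w *m pmx alpha (rho * r) *m l = 0) (w <= W')%MS.
  rewrite sub_capmx; apply: (iffP andP) => [[wW /sub_kermxP wM]|[wW wl]]; split=> //.
    move=> r; rewrite pmxM mulmxA.
    have wpp : w *m pmx alpha rho *m pmx alpha pp = 0.
      rewrite -mulmxA -pmxM mulrC -pE; have /submxP[D ->] := wW.
      by rewrite -mulmxA Wp mulmx0.
    rewrite -(mulmx_pmx_modp _ wpp) (_ : r %% pp = \sum_(j < d) (r %% pp)`_j *: 'X^j).
      rewrite pmx_sum mulmx_sumr mulmx_suml big1 // => j _.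
      rewrite pmxZ -scalemxAr -scalemxAl -mulmxA -mulmxA [X in w *m X]mulmxA -pmxM.
      suff -> : w *m (pmx alpha (rho * 'X^j) *m l) = 0 by rewrite scaler0.
      by apply/matrixP => i k; rewrite !ord1 -ME wM !mxE.
    rewrite -poly_def; apply/polyP => j; rewrite coef_poly.
    by case: ltnP => // dj; rewrite nth_default // (leq_trans (small r)).
  by apply/sub_kermxP/rowP => j; rewrite ME mulmxA wl !mxE.
have vW : (v <= W)%MS.
  by apply: submx_trans (stable_pmx rho Wa); exact: submxMr.
have indep r : (v *m pmx alpha r <= W')%MS -> pp %| r.
  case/W'P=> _ vl; rewrite -(Gauss_dvdpl r (cop _ ndvd)) /dvdp.
  set p3 := (r * rho) %% pp; apply: contraT => p3_neq0.
  (* [s] moves the leading coefficient of [p3] to degree [d - 1], where [l] reads it. *)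
  pose s := 'X^(d - size p3) : {poly F}.
  have size_s : size (p3 * s) = d.
    by rewrite /s size_mulXn // subnK // small.
  have := vl s; rewrite -(mulmxA v) -pmxM mulrA -(mulmx_pmx_modp _ v_pp).
  rewrite [(r * rho * s)%R]mulrC -modp_mul -/p3 [(s * p3)%R]mulrC modp_small ?size_s; last first.
    by rewrite /d prednK // size_poly_gt0.
  rewrite lE ?size_s // => /matrixP/(_ 0 0); rewrite !mxE mulr1n => /eqP.
  rewrite -{1}size_s -lead_coefE lead_coef_eq0 mulf_eq0 (negbTE p3_neq0).
  by rewrite /s expf_eq0 polyX_eq0 andbF.
have BW : (B <= W)%MS.
  apply/row_subP => i; rewrite rowE BE.
  by apply: submx_trans (stable_pmx (rVpoly (delta_mx 0 i)) Wa); exact: submxMr.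
have capBW' : (B :&: W' = 0)%MS.
  apply/eqP/rowV0P => w; rewrite sub_capmx => /andP[/submxP[y ->]].
  rewrite BE => /indep/dvdpP[r ->]; by rewrite mulrC pmxM mulmxA v_pp mul0mx.
have rank_BW' : \rank (B + W')%MS = (d + \rank W')%N.
  by rewrite mxrank_disjoint_sum // (eqP B_free).
have W'W : (W' <= W)%MS by exact: capmxSl.
have BW'W : (B + W' <= W)%MS by rewrite addsmx_sub BW.
(* [M] has [d] columns, so [W'] has codimension at most [d] in [W], and the cyclic space of [v]
   makes up for it. *)
have WBW' : (W <= B + W')%MS.
  rewrite -(geq_leqif (mxrank_leqif_sup BW'W)) rank_BW' -(mxrank_mul_ker W M).
  by rewrite leq_add2r rank_leq_col.
exists W', v, phi, a; split=> //.
- move=> w wW; have /sub_addsmxP[[y z] /= wE] := submx_trans wW WBW'.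
  by exists (rVpoly y); rewrite wE BE addrAC subrr add0r submxMl.
- apply/row_subP => i; rewrite row_mul; have := row_sub i W'.
  move: (row i _) => w /W'P[wW wl]; apply/W'P; split.
    by apply: submx_trans Wa; exact: submxMr.
  by move=> r; rewrite -{1}(pmxX alpha) -(mulmxA w) -pmxM mulrCA wl.
- have := mxrankS BW'W; rewrite rank_BW'; apply: leq_trans.
  by rewrite -[X in (X < _)%N]add0n ltn_add2r.
Qed.
End Split.

Section Decomposition.
Variables (F : finFieldType) (n : nat) (alpha : 'M[F]_n).
Local Notation gen := ('rV[F]_n * ({poly F} * nat))%type.
Local Notation gen0 := ((0, (0, 0)) : gen).
Implicit Types (t : seq gen) (P : nat -> {poly F}).

Definition gen_power (g : gen) : {poly F} := g.2.1 ^+ g.2.2.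

Definition gen_comb t P : 'rV[F]_n :=
  \sum_(i < size t) (nth gen0 t i).1 *m pmx alpha (P i).

Lemma gen_comb_cons g t P :
  gen_comb (g :: t) P = g.1 *m pmx alpha (P 0) + gen_comb t (fun i => P i.+1).
Proof. by rewrite /gen_comb big_ord_recl. Qed.

Lemma cyclic_generators_ex (W : 'M[F]_n) : (W *m alpha <= W)%MS ->
  exists t, [/\ forall g, g \in t ->
      [/\ g.2.1 \is monic, irreducible_poly g.2.1 & (0 < g.2.2)%N]
      /\ g.1 *m pmx alpha (gen_power g) = 0,
    forall P, (gen_comb t P <= W)%MS,
    forall w : 'rV_n, (w <= W)%MS -> exists P, w = gen_comb t P
  & forall P, gen_comb t P = 0 -> forall i, (i < size t)%N -> gen_power (nth gen0 t i) %| P i].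
Proof.
have [d] := ubnP (\rank W); elim: d W => // d IHd W /ltnSE rW Wa.
have [->|W_neq0] := eqVneq W 0.
  exists [::]; split=> // [P|w]; first by rewrite /gen_comb big_ord0 sub0mx.
  by rewrite submx0 => /eqP ->; exists (fun=> 0); rewrite /gen_comb big_ord0.
have [W' [v [phi [a [prime vW kill indep span stable sub rank_lt]]]]] :=
  cyclic_summand_ex W_neq0 Wa.
have [t [t_prime t_mem t_span t_indep]] := IHd W' (leq_trans rank_lt rW) stable.
exists ((v, (phi, a)) :: t); split.
- by move=> g; rewrite inE => /predU1P[->|/t_prime].
- move=> P; rewrite gen_comb_cons addmx_sub ?(submx_trans (t_mem _)) //=.
  by apply: submx_trans (stable_pmx (P 0%N) Wa); exact: submxMr.
- move=> w /span[p]; move=> /t_span[P wE].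
  exists (fun i => if i is j.+1 then P j else p).
  by rewrite gen_comb_cons /= -wE addrC subrK.
move=> P; rewrite gen_comb_cons /= => /eqP; rewrite addr_eq0 => /eqP vE.
have ppP : phi ^+ a %| P 0%N by apply: indep; rewrite vE eqmx_opp t_mem.
have v0 : v *m pmx alpha (P 0%N) = 0.
  by have /dvdpP[r ->] := ppP; rewrite mulrC pmxM mulmxA kill mul0mx.
case=> [|i]; first by [].
move=> it; apply: (t_indep (fun i => P i.+1)) => //.
by apply/eqP; rewrite -oppr_eq0 -vE v0.
Qed.

Lemma mk_monic_id (p : {poly F}) : p \is monic -> (1 < size p)%N -> mk_monic p = p.
Proof. by move=> p_monic p_gt1; rewrite /mk_monic p_gt1 p_monic. Qed.

(** The explicit map [e] goes from the sum of quotients to [F^n], and [f] is its inverse. This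
    existence keeps [xget] in [lambda] from returning its default. *)
Lemma cyclic_decomposition_ex : exists s, cyclic_decomposition alpha s.
Proof.
have [t [t_prime _ t_span t_indep]] := cyclic_generators_ex (submx1 (1%:M *m alpha)).
pose s := [seq g.2 | g <- t].
have sz : size s = size t by rewrite size_map.
have ppE (i : 'I_(size s)) : prime_power i = gen_power (nth gen0 t i).
  by rewrite /prime_power (tnth_nth (0, 0%N)) /= (nth_map gen0) // -sz.
have ti (i : 'I_(size s)) : nth gen0 t i \in t by rewrite mem_nth // -sz.
have pp_monic (i : 'I_(size s)) : prime_power i \is monic.
  by rewrite ppE; have [[g_monic _ _] _] := t_prime _ (ti i); rewrite monic_exp.
have pp_gt1 (i : 'I_(size s)) : (1 < size (prime_power i))%N.
  rewrite ppE; have [[g_monic [g_gt1 _] a_gt0] _] := t_prime _ (ti i).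
  exact: size_exp_gt1.
(* [{poly %/ p}] is the quotient by [mk_monic p], which must be identified with [p]. *)
have mkE (i : 'I_(size s)) : mk_monic (prime_power i) = prime_power i by exact: mk_monic_id.
exists s; split; first by move=> _ /mapP[g /t_prime[] // pr _ ->].
pose T := {dffun forall i : 'I_(size s), {poly %/ prime_power i}}.
pose e (c : T) : 'rV[F]_n :=
  \sum_(i < size s) (nth gen0 t i).1 *m pmx alpha (c i : {poly F}).
have kill (i : 'I_(size s)) : (nth gen0 t i).1 *m pmx alpha (prime_power i) = 0.
  by rewrite ppE; have [] := t_prime _ (ti i).
have in_qpolyE (i : 'I_(size s)) p :
    (in_qpoly (prime_power i) p : {poly F}) = p %% prime_power i.
  by rewrite /= -Pdiv.IdomainMonic.modpE ?monic_mk_monic // mkE.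
have e_in p : e [ffun i => in_qpoly (prime_power i) (p i)] =
    \sum_(i < size s) (nth gen0 t i).1 *m pmx alpha (p i).
  apply: eq_bigr => i _; rewrite ffunE in_qpolyE.
  by rewrite mulmx_pmx_modp.
have combE P : gen_comb t P = \sum_(i < size s) (nth gen0 t i).1 *m pmx alpha (P i).
  by rewrite /gen_comb -sz.
have e_surj w : exists c, e c = w.
  have [P ->] := t_span w (submx1 _).
  by exists [ffun i : 'I_(size s) => in_qpoly (prime_power i) (P i)]; rewrite e_in combE.
have eB c d : e c - e d = e [ffun i => c i - d i].
  rewrite /e -sumrB; apply: eq_bigr => i _.
  by rewrite ffunE -mulmxBr -pmxN -pmxD.
have e_inj : injective e.
  move=> c d /eqP; rewrite -subr_eq0 eB => /eqP e0; apply/ffunP => i.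
  apply/eqP; rewrite -subr_eq0; apply/eqP/val_inj => /=.
  pose cd := [ffun i => c i - d i] : T.
  pose P j : {poly F} := if insub j is Some i then (cd i : {poly F}) else 0.
  have PE (j : 'I_(size s)) : P j = cd j by rewrite /P valK.
  have P0 : gen_comb t P = 0.
    by rewrite combE -[RHS]e0; apply: eq_bigr => j _; rewrite PE.
  have := t_indep P P0 i; rewrite -{1}sz ltn_ord => /(_ isT).
  rewrite PE -ppE ffunE => /modp_eq0P.
  by rewrite modp_small //; apply: leq_trans (size_mk_monic _) _; rewrite mkE.
pose f w : T := projT1 (cid (e_surj w)).
have fK w : e (f w) = w by rewrite /f; case: cid.
exists f; split.
- by exists e => [w|c]; [exact: fK | apply: e_inj; rewrite fK].
- move=> i a w1 w2.
  suff -> : f (a *: w1 + w2) = [ffun i => a *: f w1 i + f w2 i] by rewrite ffunE.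
  apply: e_inj; rewrite fK -{1}(fK w1) -{1}(fK w2) /e scaler_sumr -big_split /=.
  by apply: eq_bigr => j _; rewrite ffunE /= pmxD pmxZ mulmxDr -scalemxAr.
- move=> w i.
  suff -> : f (w *m alpha) = [ffun i => 'qX * f w i] by rewrite ffunE.
  apply: e_inj; rewrite fK -{1}(fK w) /e mulmx_suml; apply: eq_bigr => j _.
  have qE : 'qX * f w j = in_qpoly (prime_power j) ('X * (f w j : {poly F})).
    by rewrite in_qpolyM; congr (_ * _); apply: val_inj; exact/esym/in_qpoly_small/size_mk_monic.
  by rewrite ffunE qE in_qpolyE mulmx_pmx_modp // mulrC pmxM pmxX mulmxA.
Qed.
End Decomposition.

Lemma monic_irreducible_coprime (F : fieldType) (phi psi : {poly F}) :
  phi \is monic -> psi \is monic -> irreducible_poly phi -> irreducible_poly psi ->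
  phi != psi -> coprimep phi psi.
Proof.
move=> phi_monic psi_monic phi_irr [_ psi_irr]; rewrite irreducible_poly_coprime //.
apply: contraNN => phi_dvd; rewrite -eqp_monic //; apply: psi_irr => //.
by case: phi_irr => phi_gt1 _; rewrite gtn_eqF.
Qed.

(** * Largest part and ranks *)

Section LargestPart.
Variables (F : finFieldType) (n : nat) (alpha : 'M[F]_n) (phi : {poly F}).
Hypotheses (phi_monic : phi \is monic) (phi_irr : irreducible_poly phi).

Lemma stable_rankP K : reflect
  (forall v : 'rV_n, v *m pmx alpha (phi ^+ K.+1) = 0 -> v *m pmx alpha (phi ^+ K) = 0)
  (stable_rank K (rank_seq phi alpha)).
Proof.
have ker_sub : (kermx (pmx alpha (phi ^+ K)) <= kermx (pmx alpha (phi ^+ K.+1)))%MS.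
  by apply/sub_kermxP; rewrite exprSr pmxM mulmxA mulmx_ker mul0mx.
have -> : stable_rank K (rank_seq phi alpha) =
    (kermx (pmx alpha (phi ^+ K.+1)) <= kermx (pmx alpha (phi ^+ K)))%MS.
  rewrite -(eq_leqif (mxrank_leqif_sup ker_sub)) !mxrank_ker /stable_rank /rank_seq.
  have := rank_leq_row (pmx alpha (phi ^+ K)); have := rank_leq_row (pmx alpha (phi ^+ K.+1)).
  by move: (\rank _) (\rank _) => i j; lia.
apply: (iffP idP) => [sub v /sub_kermxP vK|imp].
  by apply/sub_kermxP; exact: submx_trans sub.
apply/row_subP => i; apply/sub_kermxP; apply: imp.
by rewrite -row_mul mulmx_ker row0.
Qed.

(** The kernels of [phi(alpha)^(K+1)] and [phi(alpha)^K] are compared on each summand: on a power of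
    another prime [phi] is invertible and they agree, on [F[z]/(phi^b)] they agree iff [b <= K]. *)
Lemma largest_part_lt s K : cyclic_decomposition alpha s ->
  (largest_part (sort geq [seq x.2 | x <- s & x.1 == phi]) < K.+1)%N =
  stable_rank K (rank_seq phi alpha).
Proof.
case=> s_prime [f [[g fK gK] f_lin f_act]].
have si (i : 'I_(size s)) : tnth (in_tuple s) i \in s by exact: mem_tnth.
have pp_monic (i : 'I_(size s)) : prime_power i \is monic.
  by rewrite /prime_power; have [m1 _ _] := s_prime _ (si i); rewrite monic_exp.
have pp_gt1 (i : 'I_(size s)) : (1 < size (prime_power i))%N.
  by rewrite /prime_power; have [_ [g1 _] a0] := s_prime _ (si i); exact: size_exp_gt1.
have mkE (i : 'I_(size s)) : mk_monic (prime_power i) = prime_power i by exact: mk_monic_id.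
have in_qpoly_eq0 (i : 'I_(size s)) p : (in_qpoly (prime_power i) p == 0) = (prime_power i %| p).
  rewrite -val_eqE /= -Pdiv.IdomainMonic.modpE ?monic_mk_monic // mkE.
  by apply/eqP/idP => /modp_eq0P.
have fD i v w : f (v + w) i = f v i + f w i.
  by have := f_lin i 1 v w; rewrite !scale1r.
have f0 i : f 0 i = 0 by apply: (addrI (f 0 i)); rewrite -fD !addr0.
have fZ i a v : f (a *: v) i = a *: f v i.
  by have := f_lin i a v 0; rewrite f0 !addr0.
have f_pmx p v i : f (v *m pmx alpha p) i = in_qpoly (prime_power i) p * f v i.
  elim/poly_ind: p v => [|p c IHp] v; first by rewrite pmx0 mulmx0 f0 in_qpoly0 mul0r.
  rewrite pmxMXaddC mulmxDr fD mulmxA f_act IHp mul_mx_scalar fZ in_qpolyD in_qpolyM mulrDl.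
  rewrite mulrA [in_qpoly _ _ * in_qpoly _ _]mulrC; congr (_ + _).
  by rewrite -alg_polyC in_qpolyZ in_qpoly1 -scalerAl mul1r.
have f_eq0 v : (forall i, f v i = 0) -> v = 0.
  move=> v0; rewrite -[v]fK -[RHS]fK; congr g; apply/ffunP => i.
  by rewrite v0 f0.
have valq (i : 'I_(size s)) (c : {poly %/ prime_power i}) :
    c = in_qpoly (prime_power i) (c : {poly F}).
  by apply: val_inj; exact/esym/in_qpoly_small/size_mk_monic.
rewrite ltnS /largest_part; apply/idP/stable_rankP => [/bigmax_leqP_seq le_K v vK|imp].
  apply: f_eq0 => i; have := f0 i; rewrite -vK !f_pmx (valq i (f v i)) -!in_qpolyM.
  move=> /eqP; rewrite in_qpoly_eq0 => dvd_S; apply/eqP; rewrite in_qpoly_eq0.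
  have [psi_monic psi_irr a_gt0] := s_prime _ (si i).
  move: (polyn (f v i)) dvd_S => r; rewrite /prime_power.
  case E : (tnth _ i) psi_monic psi_irr a_gt0 => [psi a] /=.
  move=> psi_monic psi_irr a_gt0.
  have [psiE|psi_neq] := eqVneq psi phi.
    move=> _; rewrite psiE dvdp_mulr // dvdp_exp2l //; apply: le_K => //.
    rewrite mem_sort; apply/mapP; exists (psi, a) => //.
    by rewrite mem_filter /= psiE eqxx -psiE -E si.
  have cop : coprimep (psi ^+ a) (phi ^+ K.+1).
    by rewrite coprimep_expl // coprimep_expr // monic_irreducible_coprime.
  by rewrite Gauss_dvdpr // => dvd; rewrite dvdp_mull.
apply/bigmax_leqP_seq => a; rewrite mem_sort => /mapP[[psi b]].
rewrite mem_filter => /andP[/eqP /= psiE xs] -> _; rewrite leqNgt; apply/negP => Kb.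
have /tnthP[i iE] : (psi, b) \in in_tuple s by [].
have ppE : prime_power i = phi ^+ b by rewrite /prime_power -iE /= psiE.
(* The witness against [b > K]: [phi^(b-K-1)] in the summand [F[z]/(phi^b)] is killed by [phi^(K+1)]
   and not by [phi^K]. *)
pose c : {dffun forall j : 'I_(size s), {poly %/ prime_power j}} :=
  [ffun j => in_qpoly (prime_power j) (if j == i then phi ^+ (b - K.+1) else 0)].
have := imp (g c).
have -> : g c *m pmx alpha (phi ^+ K.+1) = 0.
  apply: f_eq0 => j; rewrite f_pmx gK ffunE -in_qpolyM; apply/eqP; rewrite in_qpoly_eq0.
  case: eqP => [->|_]; last by rewrite mulr0 dvdp0.
  by rewrite ppE -exprD subnKC.
move=> /(_ erefl) v0; have := f0 i; rewrite -v0 f_pmx gK ffunE eqxx -in_qpolyM => /eqP.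
rewrite in_qpoly_eq0 ppE -exprD => /dvdp_leq; rewrite expf_neq0 ?monic_neq0 // => /(_ isT).
apply/negP; rewrite -ltnNge.
have phi_gt1 : (1 < size phi)%N by case: phi_irr.
have bE : b = (K + (b - K.+1)).+1 by lia.
have -> : phi ^+ b = phi * phi ^+ (K + (b - K.+1)) by rewrite -exprS -bE.
by rewrite ltn_size_mul // expf_neq0 // monic_neq0.
Qed.

Lemma largest_part_lambda_lt k : (0 < k)%N ->
  (largest_part (lambda phi alpha) < k)%N = stable_rank k.-1 (rank_seq phi alpha).
Proof.
case: k => // K _; rewrite /lambda; apply: largest_part_lt.
by case: xgetP => // none; have [s /none] := cyclic_decomposition_ex alpha.
Qed.
End LargestPart.

Lemma card_GL_pred (F : finFieldType) n (P : pred 'M[F]_n.+1) :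
  #|[set g in 'GL_(n.+1)[F]%g | P (GLval g)]%SET| = #|[pred A | (A \in unitmx) && P A]|.
Proof.
rewrite -(card_imset _ (@val_inj _ _ {'GL_(n.+1)[F]})).
apply: eq_card => A; rewrite [RHS]inE; apply/imsetP/andP => [[g]|[A_unit PA]].
  by rewrite !inE => Pg ->; split=> //; exact: (valP g).
exists (Sub A A_unit : {'GL_(n.+1)[F]}); last by rewrite SubK.
by rewrite !inE.
Qed.

Lemma gl_mean_prob (R : realType) (F : finFieldType) (phi : {poly F}) k n :
  phi \is monic -> irreducible_poly phi -> (0 < k)%N ->
  prob_largest_part_lt R phi k n.+1 =
  gl_mean phi n.+1 (fun r => (stable_rank k.-1 r)%:R).
Proof.
move=> phi_monic phi_irr k_gt0; rewrite /prob_largest_part_lt /gl_mean; congr (_ / _%:R).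
  rewrite (card_GL_pred (fun A => (largest_part (lambda phi A) < k)%N)).
  rewrite -sum1_card natr_sum big_mkcondr /=; apply: eq_bigr => A _.
  by rewrite largest_part_lambda_lt //; case: stable_rank.
rewrite /gl_order -[RHS](eq_card (A := [pred A : 'M[F]_n.+1 | (A \in unitmx) && true])).
  by rewrite -card_GL_pred; apply: eq_card => g; rewrite !inE.
by move=> A; rewrite !inE andbT.
Qed.

Lemma irreducible_horner0 (F : fieldType) (phi : {poly F}) :
  phi \is monic -> irreducible_poly phi -> phi != 'X -> phi.[0] != 0.
Proof.
move=> phi_monic [_ phi_irr]; apply: contraNneq => phi0.
have X_dvd : 'X %| phi by rewrite -['X]subr0 -polyC0 dvdp_XsubCl rootE phi0.
by rewrite eq_sym -eqp_monic ?monicX // phi_irr // size_polyX.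
Qed.

Local Open Scope classical_set_scope.

Theorem theorem3 (R : realType) (F : finFieldType) (phi : {poly F}) (k : nat)
    (phi_monic : phi \is monic) (phi_irr : irreducible_poly phi)
    (phi_neqX : phi != 'X) (k_ge2 : (2 <= k)%N) :
  prob_largest_part_lt R phi k n @[n --> \oo] -->
    infinite_product
      (fun r => [|| r == 0 %[mod 2 * k + 1],
                    r == k %[mod 2 * k + 1]
                  | r + k == 0 %[mod 2 * k + 1]]%N)
      (fun r => 1 - (#|F|%:R ^+ ((size phi).-1 * r))^-1 : R).
Proof.
have k_gt0 : (0 < k)%N by exact: ltnW.
have phi0 := irreducible_horner0 phi_monic phi_irr phi_neqX.
rewrite [X in infinite_product _ X](_ : _ =
    fun r => 1 - residue_inv R phi ^+ r); last first.
  by apply/funext => r; rewrite /residue_inv exprVn -exprM.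
have x_gt0 := residue_inv_gt0 R phi; have x_le := residue_inv_le_half R phi_irr.
rewrite [infinite_product _ _](infinite_product_theta x_gt0 x_le k_gt0).
(* The shift discards [n = 0], where [{'GL_n[F]}] consists of [1 x 1] matrices and [gl_mean_prob]
   does not apply. *)
rewrite -(cvg_shiftS (prob_largest_part_lt R phi k)).
have := @stable_rank_cvg R F phi phi_monic phi_irr phi0 k k_gt0.
rewrite -(cvg_shiftS (fun n => gl_mean phi n _)); apply: cvg_trans.
by apply: near_eq_cvg; near=> n; rewrite /= gl_mean_prob.
Unshelve. all: by end_near. Qed.
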